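(* There exist $\alpha_0,\beta_0$ with $\alpha_0\eqsim1$, $\beta_0\eqsim\lambda^{-1}$ such that for all $\alpha\ge\alpha_0$, $\beta\ge\beta_0$ and all $(u,y,p),(v,z,q)\in X\times Y\times Y^\star$, \begin{align*} |\!|\!|(u,y,p)|\!|\!|_\lambda^2&\lesssim a(u,y,p;u,y,p),\\ |a(u,y,p;v,z,q)|&\lesssim\max\{\alpha,\lambda\beta\}\,|\!|\!|(u,y,p)|\!|\!|_\lambda\,|\!|\!|(v,z,q)|\!|\!|_\lambda, \end{align*} i.e., the bilinear form $a$ is coercive and bounded with respect to $|\!|\!|\cdot|\!|\!|_\lambda$. Moreover (for all such $\alpha,\beta$), for any non-empty closed convex subset $W\subseteq X\times Y\times Y^\star$, the variational inequality to find $(u,y,p)\in W$ such that $$a(u,y,p;\,v-u,z-y,q-p)\ge\ell(v-u,z-y,q-p)\qquad\text{for all }(v,z,q)\in W$$ admits a unique solution. In particular, the problem to find $(u,y,p)\in X_{\mathrm{ad}}\times Y\times Y^\star$ satisfying this inequality for all $(v,z,q)\in X_{\mathrm{ad}}\times Y\times Y^\star$ admits a unique solution, and, respectively, the problem to find $(u,y,p)\in X_{\mathrm{ad}}\times Y\times Y^\star$ with $\mathcal{L}y=f-\mathcal{B}u$, $\mathcal{L}^\star p=\mathcal{A}^*(\mathcal{A}\mathcal{I}y-z_d)$ and $(-\mathcal{B}^*\mathcal{I}^\star p+\lambda\mathcal{C}u,v-u)_X\ge0$ for all $v\in X_{\mathrm{ad}}$ admits a unique solution.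
   Context: All Hilbert spaces are real; $(\cdot,\cdot)_V$ and $\|\cdot\|_V$ denote the inner product and norm of a Hilbert space $V$; products carry the norm $\|(x_1,\dots,x_n)\|^2=\sum_j\|x_j\|^2$. Let $H,X,Y,Y^\star$ be Hilbert spaces ($Y^\star$ is simply another Hilbert space, not necessarily the dual of $Y$), let $X_{\mathrm{ad}}\subseteq X$ be non-empty, closed and convex, and let $Z=\boldsymbol{L}^2(\Omega_1)\times\cdots\times\boldsymbol{L}^2(\Omega_n)$, where $\Omega_1,\dots,\Omega_n$ are Lipschitz domains and each $\boldsymbol{L}^2(\Omega_j)$ is a Lebesgue space of square-integrable scalar- or vector-valued functions. Let $\mathcal{A}\colon Z\to H$, $\mathcal{B}\colon X\to Z$, $\mathcal{C}\colon X\to X$ be bounded linear operators with (Hilbert space) adjoints $\mathcal{A}^*\colon H\to Z$, $\mathcal{B}^*\colon Z\to X$, where $\mathcal{C}=\mathcal{C}^*$ and there is $\kappa>0$ with $(\mathcal{C}u,u)_X\ge\kappa\|u\|_X^2$ for all $u\in X$. Let $\mathcal{L}\colon Y\to Z$ and $\mathcal{L}^\star\colon Y^\star\to Z$ be bounded linear bijections, and let $\mathcal{I}\colon Y\to Z$, $\mathcal{I}^\star\colon Y^\star\to Z$ be bounded linear operators with $(\mathcal{L}y,\mathcal{I}^\star p)_Z=(\mathcal{I}y,\mathcal{L}^\star p)_Z$ for all $y\in Y$, $p\in Y^\star$. Let $0<\lambda\le1$, $f\in Z$, $z_d\in H$. For $u\in X$, $y\in Y$ let $y_u\in Y$ and $p_y\in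 Y^\star$ be the unique solutions of $\mathcal{L}y_u=-\mathcal{B}u$ and $\mathcal{L}^\star p_y=\mathcal{A}^*\mathcal{A}\mathcal{I}y$. Define the norm $$|\!|\!|(u,y,p)|\!|\!|_\lambda^2=\lambda\|u\|_X^2+\|y-y_u\|_Y^2+\lambda^{-1}\|p-p_y\|_{Y^\star}^2+\|\mathcal{A}\mathcal{I}y_u\|_H^2.$$ For constants $\alpha,\beta>0$ and $u,v\in X$, $y,z\in Y$, $p,q\in Y^\star$ define \begin{align*} a(u,y,p;v,z,q)&=\alpha(\mathcal{L}y+\mathcal{B}u,\mathcal{L}z+\mathcal{B}v)_Z+\beta(\mathcal{L}^\star p-\mathcal{A}^*\mathcal{A}\mathcal{I}y,\mathcal{L}^\star q-\mathcal{A}^*\mathcal{A}\mathcal{I}z)_Z+(-\mathcal{B}^*\mathcal{I}^\star p+\lambda\mathcal{C}u,v)_X,\\ \ell(v,z,q)&=\alpha(f,\mathcal{L}z+\mathcal{B}v)_Z+\beta(-\mathcal{A}^*z_d,\mathcal{L}^\star q-\mathcal{A}^*\mathcal{A}\mathcal{I}z)_Z. \end{align*} $A\lesssim B$ means $A\le C\,B$ with a constant $C>0$ independent of $\lambda\in(0,1]$, of $\alpha,\beta$, and of the elements of the spaces involved (the spaces and operators being fixed); $A\eqsim B$ means $A\lesssim B\lesssim A$. The thresholds $\alpha_0,\beta_0$ may depend on $\lambda$. *)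

(* Defs.v *)
From HB Require Import structures.
From mathcomp Require Import all_boot all_order all_algebra.
From mathcomp Require Import all_classical all_reals all_analysis.
From mathcomp Require Import measurable_realfun ring lra.
Set Implicit Arguments.
Unset Strict Implicit.
Unset Printing Implicit Defensive.
Import Order.TTheory GRing.Theory Num.Theory.
Import numFieldNormedType.Exports.
Local Open Scope classical_set_scope.
Local Open Scope ring_scope.

HB.mixin Record CompleteNormedModule_isHilbert (R : realType) V
    & CompleteNormedModule R V := {
  inner : V -> V -> R;
  innerC : forall u v, inner u v = inner v u;
  inner_linearl : forall (a : R) u v w,
    inner (a *: u + v) w = a * inner u w + inner v w;
  inner_norm : forall u, inner u u = `|u| ^+ 2
}.

#[short(type="hilbertType")]
HB.structure Definition Hilbert (R : realType) :=
  {V of CompleteNormedModule R V & CompleteNormedModule_isHilbert R V}.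

HB.factory Record Lmodule_isHilbert (R : realType) V & GRing.Lmodule R V := {
  inner : V -> V -> R;
  innerC : forall u v, inner u v = inner v u;
  inner_linearl : forall (a : R) u v w,
    inner (a *: u + v) w = a * inner u w + inner v w;
  inner_ge0 : forall u, 0 <= inner u u;
  inner_eq0 : forall u, inner u u = 0 -> u = 0;
  inner_complete : forall u_ : nat -> V,
    (forall e : R, 0 < e -> exists N, forall m n, (N <= m)%N -> (N <= n)%N ->
       inner (u_ m - u_ n) (u_ m - u_ n) < e) ->
    exists l, forall e : R, 0 < e -> exists N, forall n, (N <= n)%N ->
       inner (u_ n - l) (u_ n - l) < e
}.

HB.builders Context R V & Lmodule_isHilbert R V.

Let nrm (u : V) : R := Num.sqrt (inner u u).

Let innerDl u v w : inner (u + v) w = inner u w + inner v w.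
Proof. by rewrite -[u in LHS]scale1r inner_linearl mul1r. Qed.

Let inner0l w : inner 0 w = 0.
Proof. by apply: (addIr (inner 0 w)); rewrite -innerDl addr0 add0r. Qed.

Let innerZl a u w : inner (a *: u) w = a * inner u w.
Proof. by rewrite -[a *: u]addr0 inner_linearl inner0l addr0. Qed.


Let inner_expand t u v :
  inner (t *: u + v) (t *: u + v)
  = t ^+ 2 * inner u u + 2 * t * inner u v + inner v v.
Proof.
rewrite inner_linearl !(innerC _ (t *: u + v)) !inner_linearl (innerC v u).
by ring.
Qed.

Let cauchy_schwarz u v : inner u v ^+ 2 <= inner u u * inner v v.
Proof.
have [uu0|uu0] := eqVneq (inner u u) 0.
  by rewrite (inner_eq0 uu0) !inner0l expr0n mul0r.
have uu_gt0 : 0 < inner u u by rewrite lt_neqAle eq_sym uu0 inner_ge0.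
have := inner_ge0 (- (inner u v / inner u u) *: u + v).
rewrite inner_expand.
have -> : (- (inner u v / inner u u)) ^+ 2 * inner u u +
    2 * - (inner u v / inner u u) * inner u v + inner v v
  = inner v v - inner u v ^+ 2 / inner u u by field.
by rewrite subr_ge0 ler_pdivrMr// mulrC.
Qed.

Let nrm_ge0 u : 0 <= nrm u. Proof. exact: sqrtr_ge0. Qed.

Let nrm_sqr u : nrm u ^+ 2 = inner u u.
Proof. exact: (sqr_sqrtr (inner_ge0 u)). Qed.

Let ler_nrmD u v : nrm (u + v) <= nrm u + nrm v.
Proof.
rewrite -(ler_pXn2r (ltn0Sn 1)) ?nnegrE ?addr_ge0// sqrrD !nrm_sqr.
have := inner_expand 1 u v; rewrite scale1r => ->.
suff : inner u v <= nrm u * nrm v by move=> ?; rewrite -mulr_natl; lra.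
rewrite (le_trans (ler_norm _))// -(ler_pXn2r (ltn0Sn 1)) ?nnegrE ?mulr_ge0//.
by rewrite real_normK ?num_real// exprMn !nrm_sqr cauchy_schwarz.
Qed.

Let nrmZ (l : R) u : nrm (l *: u) = `|l| * nrm u.
Proof.
rewrite /nrm innerZl innerC innerZl mulrA -expr2 sqrtrM ?sqr_ge0//.
by rewrite sqrtr_sqr.
Qed.

Let nrm0_eq0 u : nrm u = 0 -> u = 0.
Proof. by move=> u0; apply: inner_eq0; rewrite -nrm_sqr u0 expr0n. Qed.

HB.instance Definition _ := @Lmodule_isNormed.Build R V nrm
  ler_nrmD nrmZ nrm0_eq0.

Let nrm_complete (F : set_system V) : ProperFilter F -> cauchy F -> cvg F.
Proof.
move=> FF /cauchyP Fc.
pose e_ (n : nat) : R := n.+1%:R^-1.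
have e_gt0 n : 0 < e_ n by rewrite invr_gt0.
have /choice[u_ Fu] : forall n, exists x, F (ball x (e_ n)).
  by move=> n; have [x] := Fc _ (e_gt0 n); exists x.
have e_le m n : (m <= n)%N -> e_ n <= e_ m.
  by move=> mn; rewrite lef_pV2 ?posrE// ler_nat.
have dist m n : `|u_ m - u_ n| < e_ m + e_ n.
  have [z [mz nz]] := filter_ex (filterI (Fu m) (Fu n)).
  move: mz nz; rewrite -!ball_normE /= => mz nz.
  rewrite -[u_ m](subrK z) -addrA (le_lt_trans (ler_normD _ _))// ltrD//.
  by rewrite distrC.
have small (e : R) : 0 < e -> exists N, e_ N < e.
  by move=> e0; exists (Num.truncn e^-1);
     rewrite invf_plt ?posrE// truncnS_gt.
have [e e0|l ul] := @inner_complete u_.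
  have se0 : 0 < Num.sqrt e by rewrite sqrtr_gt0.
  have [N Ne] := small (Num.sqrt e / 2) (divr_gt0 se0 (ltr0Sn R 1)).
  exists N => m n Nm Nn; rewrite -nrm_sqr -[ltRHS]sqr_sqrtr ?ltW//.
  rewrite ltr_pXn2r ?nnegrE// (lt_le_trans (dist _ _))//.
  by rewrite [leRHS]splitr lerD//; apply: le_trans (ltW Ne); apply: e_le.
apply/cvg_ex; exists l; apply/cvg_ballP => e e0.
have e20 : 0 < e / 2 by rewrite divr_gt0.
have [N Ne] := small _ e20.
have [N' uN'] := ul _ (exprn_gt0 2 e20).
pose M := maxn N N'.
apply: filterS (Fu M) => x; rewrite -!ball_normE /= => Mx.
rewrite -[l](subrK (u_ M)) -addrA (le_lt_trans (ler_normD _ _))//.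
rewrite [ltRHS]splitr ltrD//; last first.
  by rewrite (lt_le_trans Mx)// ltW// (le_lt_trans _ Ne)// e_le// leq_maxl.
rewrite distrC -(ltr_pXn2r (ltn0Sn 1)) ?nnegrE ?(ltW e20)//.
by rewrite [ltLHS]nrm_sqr uN'// leq_maxr.
Qed.

HB.instance Definition _ := Uniform_isComplete.Build V nrm_complete.

HB.instance Definition _ := CompleteNormedModule_isHilbert.Build R V
  innerC inner_linearl (fun u => esym (nrm_sqr u)).

HB.end.

Section L2_functions.
Context d (T : measurableType d) (R : realType) (mu : {measure set T -> \bar R}).
Local Notation L2fun := (LfunType mu (lee1n 2)).

Lemma L2fun_measurable (f : L2fun) : measurable_fun setT (f : T -> R).
Proof. exact: measurable_funPT. Qed.

Lemma L2fun_mul_integrable (f g : L2fun) :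
  mu.-integrable setT (EFin \o (fun x => f x * g x)).
Proof. by apply/Lfun1_integrable; apply: Lfun2_mul_Lfun1; exact: LfunP. Qed.

Lemma L2fun_sqr (f : L2fun) :
  (\int[mu]_x f x ^+ 2)%:E = (\int[mu]_x (f x ^+ 2)%:E)%E.
Proof.
by rewrite /Rintegral fineK//; apply: integrable_fin_num => //;
  apply: Lfun2_integrable_sqr; exact: LfunP.
Qed.

Lemma L2funP (f : T -> R) : measurable_fun setT f ->
  (\int[mu]_x (f x ^+ 2)%:E < +oo)%E -> f \in Lfun mu 2%:E.
Proof.
move=> mf foo; rewrite inE; apply/andP; split; rewrite inE//=.
rewrite /finite_norm unlock poweR_lty//.
by under eq_integral do
  rewrite /= powR_mulrn ?normr_ge0// real_normK ?num_real//.
Qed.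

Lemma Rintegral_ae_eq (f g : T -> R) : measurable_fun setT f ->
  measurable_fun setT g -> f = g %[ae mu] ->
  \int[mu]_x f x = \int[mu]_x g x.
Proof.
move=> mf mg fg; rewrite /Rintegral; congr fine.
apply: ae_eq_integral => //; [exact/measurable_EFinP|exact/measurable_EFinP|].
by apply: filterS fg => x fg /fg/= ->.
Qed.

Lemma L2fun_complete (u : nat -> L2fun) :
  (forall e : R, 0 < e -> exists N, forall m n, (N <= m)%N -> (N <= n)%N ->
     \int[mu]_x (u m x - u n x) ^+ 2 < e) ->
  exists l : L2fun, forall e : R, 0 < e -> exists N, forall n, (N <= n)%N ->
     \int[mu]_x (u n x - l x) ^+ 2 < e.
Proof.
move=> uc.
pose S m n := \int[mu]_x (u m x - u n x) ^+ 2.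
have SE m n : ((S m n)%:E = \int[mu]_x ((u m x - u n x) ^+ 2)%:E)%E.
  exact: (L2fun_sqr (u m - u n)).
have mu2 m n : measurable_fun setT (fun x => (u m x - u n x) ^+ 2).
  by apply: measurable_funX; apply: measurable_funB; exact: L2fun_measurable.
have /choice[N_ NP] : forall k : nat, exists N, forall m n, (N <= m)%N ->
    (N <= n)%N -> S m n < (8 ^+ k)^-1.
  by move=> k; apply: uc; rewrite invr_gt0 exprn_gt0.
pose phi k := (\sum_(j < k.+1) (N_ j).+1)%N.
have phi_ge k : (N_ k <= phi k)%N by rewrite /phi big_ord_recr/= ltnW// leq_addl.
have phi_id k : (k <= phi k)%N.
  rewrite -[leqLHS]card_ord -sum1_card /phi big_ord_recr/=.
  by rewrite (leq_trans _ (leq_addr _ _))// leq_sum.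
have phiS k : (phi k <= phi k.+1)%N by rewrite /phi [leqRHS]big_ord_recr leq_addr.
have phi_mono k j : (k <= j)%N -> (phi k <= phi j)%N.
  exact: (homo_leq leqnn leq_trans).
pose v k x := u (phi k) x.
have mv k : measurable_fun setT (v k) by exact: L2fun_measurable.
pose G k x := ((4 ^+ k)%:E * ((v k.+1 x - v k x) ^+ 2)%:E)%E.
have G0 k x : (0 <= G k x)%E.
  by rewrite /G -EFinM lee_fin mulr_ge0 ?sqr_ge0.
have mG k : measurable_fun setT (G k).
  apply/measurable_EFinP; apply: measurable_funM => //; exact: mu2.
have intG k : (\int[mu]_x G k x <= (2 / (2 ^ k.+1)%:R)%:E)%E.
  rewrite ge0_integralZl//.
  - rewrite -SE -EFinM lee_fin /=.
    have -> : 2 / (2 ^ k.+1)%:R = (2^-1) ^+ k :> R.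
      by rewrite natrX exprS invfM mulrA divff// mul1r exprVn.
    have /ltW := NP k (phi k.+1) (phi k) (leq_trans (phi_ge k) (phiS k)) (phi_ge k).
    move=> /(ler_wpM2l (exprn_ge0 k (ler0n R 4))) /le_trans; apply.
    by rewrite -exprVn -exprMn (_ : 4 * 8^-1 = 2^-1 :> R)//; field.
  - exact/measurable_EFinP/mu2.
  - by move=> x _; rewrite lee_fin sqr_ge0.
have sumG : (\int[mu]_x (\sum_(k <oo) G k x) < +oo)%E.
  rewrite integral_nneseries//.
  apply: (@le_lt_trans _ _ (\sum_(k <oo) (2 / (2 ^ k.+1)%:R)%:E)%E).
    by apply: lee_nneseries => [k *|k *]; [exact: integral_ge0|exact: intG].
  exact: le_lt_trans (epsilon_trick0 xpredT (ler0n R 2)) (ltry _).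
have aeG : \forall x \ae mu, (\sum_(k <oo) G k x)%E \is a fin_num.
  have : mu.-integrable setT (fun x => \sum_(k <oo) G k x)%E.
    apply/integrableP; split.
      exact: ge0_emeasurable_sum.
    under eq_integral do rewrite gee0_abs ?nneseries_ge0//.
    exact: sumG.
  by move/(integrable_ae measurableT); apply: filterS => x; exact.
pose f x := fine (limn_esup (fun k => (v k x)%:E)).
have mf : measurable_fun setT f.
  apply: measurableT_comp; first exact: fine_measurable.
  by apply: measurable_fun_limn_esup => k; exact/measurable_EFinP.
have vf : \forall x \ae mu, v k x @[k --> \oo] --> f x.
  apply: filterS aeG => x Gx.
  suff cv : cvgn (v ^~ x).
    have cvE : (v k x)%:E @[k --> \oo] --> (limn (v ^~ x))%:E.
      by apply: cvg_EFin => //; exact: nearW.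
    by rewrite /f (cvg_limn_einf_sup cvE).2.
  pose M := fine (\sum_(k <oo) G k x)%E.
  have GM k : 4 ^+ k * (v k.+1 x - v k x) ^+ 2 <= M.
    rewrite -lee_fin fineK//.
    apply: le_trans (nneseries_lim_ge k.+1 (fun n _ _ => G0 n x)).
    by rewrite big_nat_recr//= leeDr// sume_ge0.
  have M0 : 0 <= M by apply: le_trans _ (GM 0%N); rewrite mulr_ge0 ?sqr_ge0.
  have : cvgn (series (telescope (v ^~ x))).
    apply: normed_cvg.
    apply: (@series_le_cvg _ _ (geometric (Num.sqrt M) 2^-1)).
    - by move=> k; exact: normr_ge0.
    - by move=> k /=; rewrite mulr_ge0 ?sqrtr_ge0// exprn_ge0.
    - move=> k /=.
      rewrite -(ler_pXn2r (ltn0Sn 1)) ?nnegrE ?mulr_ge0 ?sqrtr_ge0 ?exprn_ge0//.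
      rewrite real_normK ?num_real// exprMn sqr_sqrtr// -exprM mulnC exprM exprVn.
      rewrite -natrX exprVn ler_pdivlMr ?exprn_gt0// mulrC.
      exact: GM.
    - by apply: is_cvg_geometric_series; rewrite ger0_norm// invf_lt1// ltr1n.
  rewrite telescopeK => cv.
  have -> : v ^~ x = (fun n => (v n x - v 0 x) + v 0 x) by apply/funext => n; rewrite subrK.
  by apply: is_cvgD => //; exact: is_cvg_cst.
have fat (e : R) N n : (forall m, (N <= m)%N -> S m n <= e) ->
    (\int[mu]_x ((f x - u n x) ^+ 2)%:E <= e%:E)%E.
  move=> Se.
  pose h k x := ((v k x - u n x) ^+ 2)%:E.
  have mh k : measurable_fun setT (h k) by apply/measurable_EFinP/mu2.
  have h0 k x : (0 <= h k x)%E by rewrite lee_fin sqr_ge0.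
  rewrite (@ge0_ae_eq_integral _ _ _ mu _ _ (fun x => limn_einf (h ^~ x)))//.
  - apply: le_trans (fatou _ _ _ _) _ => //.
    rewrite limn_einf_lim; apply: lime_le; first exact: is_cvg_einfs.
    apply: nearW => k.
    pose m := maxn N k.
    have : (einfs (fun k => \int[mu]_x h k x) k <= \int[mu]_x h m x)%E.
      by apply: ereal_inf_lbound; exists m => //=; rewrite leq_maxr.
    move=> /le_trans; apply; rewrite /h /v -SE lee_fin Se//.
    by rewrite (leq_trans _ (phi_id m))// leq_maxl.
  - apply/measurable_EFinP; apply: measurable_funX; apply: measurable_funB;
      [exact: mf|exact: L2fun_measurable].
  - rewrite (_ : (fun _ => _) = fun x => limn_esup (fun k => einfs (h ^~ x) k)).
      by apply: measurable_fun_limn_esup => k; exact: measurable_fun_einfs.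
    apply/funext => x; rewrite limn_einf_lim is_cvg_limn_esupE//.
    exact: is_cvg_einfs.
  - by move=> x _; rewrite lee_fin sqr_ge0.
  - move=> x _; rewrite limn_einf_lim; apply: lime_ge; first exact: is_cvg_einfs.
    by apply: nearW => k; apply: le_ereal_inf_tmp => _ [m /= _ <-].
  - apply: filterS vf => x vx _.
    have cvE : h k x @[k --> \oo] --> ((f x - u n x) ^+ 2)%:E.
      apply: cvg_EFin; first exact: nearW.
      by rewrite /h/=; apply: cvgM; apply: cvgB => //; exact: cvg_cst.
    by rewrite (cvg_limn_einf_sup cvE).1.
have [N1 N1P] := uc 1 ltr01.
have fN1 : (f \- u N1) \in Lfun mu 2%:E.
  apply: L2funP; first by apply: measurable_funB => //; exact: L2fun_measurable.
  apply: le_lt_trans (fat 1 N1 N1 _) (ltry _) => m mN1.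
  by apply/ltW/N1P.
have fL : f \in Lfun mu 2%:E.
  have -> : f = (f \- u N1) + (u N1 : T -> R).
    by apply/funext => x /=; rewrite [RHS]subrK.
  by apply: (@Lfun_addr_closed _ _ _ mu 2%:E (lee1n 2)).2 => //; exact: LfunP.
exists (Lfun_Sub (lee1n 2) fL) => e e0.
have [N NE] := uc _ (divr_gt0 e0 (ltr0Sn R 1)).
exists N => n Nn.
have : (\int[mu]_x (f x - u n x) ^+ 2)%:E = (\int[mu]_x ((f x - u n x) ^+ 2)%:E)%E.
  exact: (L2fun_sqr (Lfun_Sub (lee1n 2) fL - u n)).
have : (\int[mu]_x ((f x - u n x) ^+ 2)%:E <= (e / 2)%:E)%E.
  by apply: (fat _ N) => m Nm; exact/ltW/NE.
move=> + E; rewrite -E lee_fin => fe.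
rewrite (_ : Rintegral _ _ _ = \int[mu]_x (f x - u n x) ^+ 2); last first.
  by apply: eq_Rintegral => x _; rewrite -[LHS]sqrrN opprB.
by rewrite (le_lt_trans fe)// ltr_pdivrMr// mulr_natr mulr2n ltrDl.
Qed.
End L2_functions.

Section L2_space.
Context d (T : measurableType d) (R : realType) (mu : {measure set T -> \bar R}).
Local Notation L2fun := (LfunType mu (lee1n 2)).

(* The type of [mu]-almost everywhere classes of square-integrable functions;
   the library provides this quotient without any algebraic structure. *)
Definition L2 : Type := LspaceType2 mu.

HB.instance Definition _ := gen_eqMixin L2.
HB.instance Definition _ := gen_choiceMixin L2.

Let mfun_of_L2fun_subproof (h : L2fun) :
  measurable_fun setT (h : T -> measurableTypeR R).
Proof. exact: L2fun_measurable. Qed.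

Let mfun_of_L2fun (h : L2fun) : {mfun T >-> measurableTypeR R} :=
  HB.pack (h : T -> measurableTypeR R)
    (isMeasurableFun.Build _ _ _ _ _ (mfun_of_L2fun_subproof h)).

Definition L2_repr (f : L2) : T -> R := repr (LebesgueSpace.sort f).

Lemma L2_repr_Lfun (f : L2) : L2_repr f \in Lfun mu 2%:E.
Proof.
rewrite inE; apply/andP; split; rewrite inE/=.
  exact: (@measurable_funPT _ _ _ _ (repr (LebesgueSpace.sort f))).
exact: (@Lebesgue_finite _ _ _ _ _ _ f).
Qed.

Definition L2fun_of (f : L2) : L2fun := Lfun_Sub (lee1n 2) (L2_repr_Lfun f).

Let pi_class (h : L2fun) : {mfun_ mu, T >-> measurableTypeR R} :=
  (\pi_({mfun_ mu, T >-> measurableTypeR R}) (mfun_of_L2fun h))%qT.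

Let pi_class_ae (h : L2fun) : (repr (pi_class h) : T -> R) = h %[ae mu].
Proof.
have : (repr (pi_class h) == mfun_of_L2fun h
         %[mod {mfun_ mu, T >-> measurableTypeR R}])%qT.
  by rewrite reprK.
by rewrite eqmodE => /asboolP.
Qed.

Let pi_class_finite (h : L2fun) : finite_norm mu 2 (pi_class h : T -> R).
Proof.
have mp : measurable_fun setT (pi_class h : T -> R).
  exact: (@measurable_funPT _ _ _ _ (repr (pi_class h))).
have mh := L2fun_measurable h.
have /L2funP : (\int[mu]_x ((pi_class h : T -> R) x ^+ 2)%:E < +oo)%E.
  rewrite (@ge0_ae_eq_integral _ _ _ mu _ _ (fun x => (h x ^+ 2)%:E))//.
  - by rewrite -L2fun_sqr ltry.
  - exact/measurable_EFinP/measurable_funX.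
  - exact/measurable_EFinP/measurable_funX.
  - by move=> x _; rewrite lee_fin sqr_ge0.
  - by move=> x _; rewrite lee_fin sqr_ge0.
  - by apply: filterS (pi_class_ae h) => x hx /hx <-.
by move=> /(_ mp) /sub_Lfun_finLfun; rewrite inE.
Qed.

Definition L2_class (h : L2fun) : L2 :=
  HB.pack (pi_class h) (isFinLebesgue.Build _ _ _ _ _ (lee1n 2) _ (pi_class_finite h)).

Lemma L2_classE (h : L2fun) : (L2fun_of (L2_class h) : T -> R) = h %[ae mu].
Proof. exact: pi_class_ae. Qed.

Lemma L2P (f g : L2) : (L2fun_of f : T -> R) = L2fun_of g %[ae mu] -> f = g.
Proof.
case: f g => [f [[pf]]] [g [[pg]]] /= fg.
have E : f = g.
  apply/eqP; rewrite -[f]reprK -[g]reprK; rewrite eqmodE.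
  exact/asboolP.
by rewrite E in pf fg *; rewrite (bool_irrelevance pf pg).
Qed.

Let L2_eq (h k : L2fun) : (h : T -> R) = k %[ae mu] -> L2_class h = L2_class k.
Proof.
move=> hk; apply: L2P; move: (L2_classE h) (L2_classE k) hk.
by apply: filterS3 => x hx kx e xT; rewrite hx// kx// e.
Qed.

Let L2_classK (f : L2) : L2_class (L2fun_of f) = f.
Proof. by apply: L2P; exact: L2_classE. Qed.

Let L2_add (f g : L2) := L2_class (L2fun_of f + L2fun_of g).
Let L2_opp (f : L2) := L2_class (- L2fun_of f).
Let L2_scale (a : R) (f : L2) := L2_class (a *: L2fun_of f).

Let L2_addE (h k : L2fun) :
  L2_add (L2_class h) (L2_class k) = L2_class (h + k).
Proof.
apply: L2_eq; move: (L2_classE h) (L2_classE k).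
apply: filterS2 => x hx kx xT.
by rewrite -[LHS]/(L2fun_of (L2_class h) x + L2fun_of (L2_class k) x) hx// kx.
Qed.

Let L2_oppE (h : L2fun) : L2_opp (L2_class h) = L2_class (- h).
Proof.
apply: L2_eq; move: (L2_classE h); apply: filterS => x hx xT.
by rewrite -[LHS]/(- L2fun_of (L2_class h) x) hx.
Qed.

Let L2_scaleE a (h : L2fun) : L2_scale a (L2_class h) = L2_class (a *: h).
Proof.
apply: L2_eq; move: (L2_classE h); apply: filterS => x hx xT.
by rewrite -[LHS]/(a * L2fun_of (L2_class h) x) hx.
Qed.

Let L2_addA : associative L2_add.
Proof.
by move=> f g h; rewrite -[f]L2_classK -[g]L2_classK -[h]L2_classK !L2_addE addrA.
Qed.

Let L2_addC : commutative L2_add.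
Proof. by move=> f g; rewrite /L2_add addrC. Qed.

Let L2_add0 : left_id (L2_class 0) L2_add.
Proof. by move=> f; rewrite -[f in LHS]L2_classK L2_addE add0r L2_classK. Qed.

Let L2_addN : left_inverse (L2_class 0) L2_opp L2_add.
Proof. by move=> f; rewrite -[f]L2_classK L2_oppE L2_addE addNr. Qed.

HB.instance Definition _ :=
  GRing.isZmodule.Build L2 L2_addA L2_addC L2_add0 L2_addN.

Lemma L2_classD h k : L2_class (h + k) = L2_class h + L2_class k.
Proof. by rewrite -[RHS]/(L2_add _ _) L2_addE. Qed.

Let L2_scaleA a b f : L2_scale a (L2_scale b f) = L2_scale (a * b) f.
Proof. by rewrite L2_scaleE scalerA. Qed.

Let L2_scale1 : left_id 1 L2_scale.
Proof. by move=> f; rewrite /L2_scale scale1r L2_classK. Qed.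

Let L2_scaleDr : right_distributive L2_scale +%R.
Proof.
move=> a f g; rewrite -[f]L2_classK -[g]L2_classK -L2_classD !L2_scaleE.
by rewrite -L2_classD scalerDr.
Qed.

Let L2_scaleDl f : {morph L2_scale^~ f : a b / a + b}.
Proof. by move=> a b; rewrite -L2_classD -scalerDl. Qed.

HB.instance Definition _ := GRing.Zmodule_isLmodule.Build R L2
  L2_scaleA L2_scale1 L2_scaleDr L2_scaleDl.

Lemma L2_classZ a h : L2_class (a *: h) = a *: L2_class h.
Proof. by rewrite -[RHS]/(L2_scale _ _) L2_scaleE. Qed.

Lemma L2_classB h k : L2_class (h - k) = L2_class h - L2_class k.
Proof. by rewrite -scaleN1r L2_classD L2_classZ scaleN1r. Qed.

Let L2_inner (f g : L2) : R := \int[mu]_x (L2fun_of f x * L2fun_of g x).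

Let L2_innerE (h k : L2fun) :
  L2_inner (L2_class h) (L2_class k) = \int[mu]_x (h x * k x).
Proof.
apply: Rintegral_ae_eq.
- by apply: measurable_funM; exact: L2fun_measurable.
- by apply: measurable_funM; exact: L2fun_measurable.
- move: (L2_classE h) (L2_classE k); apply: (@filterS2 _ (almost_everywhere mu)).
  by move=> x hx kx xT; rewrite hx// kx.
Qed.

Let L2_innerC f g : L2_inner f g = L2_inner g f.
Proof. by apply: eq_Rintegral => x _; rewrite mulrC. Qed.

Let L2_inner_linearl (a : R) f g h :
  L2_inner (a *: f + g) h = a * L2_inner f h + L2_inner g h.
Proof.
rewrite -[f]L2_classK -[g]L2_classK -[h]L2_classK.
rewrite -L2_classZ -L2_classD !L2_innerE.
move: (L2fun_of f) (L2fun_of g) (L2fun_of h) => {}f {}g {}h.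
rewrite -RintegralZl//; last exact: L2fun_mul_integrable.
rewrite -RintegralD//; last 2 first.
- have := L2fun_mul_integrable (a *: f) h.
  by apply: eq_integrable => // x _ /=; rewrite -mulrA.
- exact: L2fun_mul_integrable.
by apply: eq_Rintegral => x _ /=; rewrite mulrDl -mulrA.
Qed.

Let L2_inner_ge0 f : 0 <= L2_inner f f.
Proof. by apply: Rintegral_ge0 => x _; rewrite -expr2 sqr_ge0. Qed.

Let L2_inner_eq0 f : L2_inner f f = 0 -> f = 0.
Proof.
move=> f0; rewrite -[f]L2_classK; apply: L2_eq.
have : (\int[mu]_x `|(L2fun_of f x ^+ 2)%:E| = 0)%E.
  under eq_integral do rewrite gee0_abs ?lee_fin ?sqr_ge0//.
  by rewrite -L2fun_sqr; congr EFin.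
have mf2 : measurable_fun setT (EFin \o (fun x => L2fun_of f x ^+ 2)).
  exact/measurable_EFinP/measurable_funX/L2fun_measurable.
move=> /(ae_eq_integral_abs mu measurableT mf2).1 ae0.
apply: filterS ae0 => x fx xT; have [/eqP] := fx xT.
by rewrite sqrf_eq0 => /eqP.
Qed.

Let L2_inner_complete (u : nat -> L2) :
  (forall e : R, 0 < e -> exists N, forall m n, (N <= m)%N -> (N <= n)%N ->
     L2_inner (u m - u n) (u m - u n) < e) ->
  exists l, forall e : R, 0 < e -> exists N, forall n, (N <= n)%N ->
     L2_inner (u n - l) (u n - l) < e.
Proof.
have uE m l : L2_inner (u m - L2_class l) (u m - L2_class l)
    = \int[mu]_x (L2fun_of (u m) x - l x) ^+ 2.
  rewrite -[u m]L2_classK -L2_classB L2_innerE L2_classK.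
  by apply: eq_Rintegral => x _; rewrite expr2.
move=> uc.
have [|l lP] := @L2fun_complete _ _ _ mu (fun n => L2fun_of (u n)).
  move=> e /uc[N NP]; exists N => m n Nm Nn.
  by have := NP _ _ Nm Nn; rewrite -[u n]L2_classK uE L2_classK.
exists (L2_class l) => e /lP[N NP]; exists N => n Nn.
by rewrite uE NP.
Qed.

HB.instance Definition _ := Lmodule_isHilbert.Build R L2
  L2_innerC L2_inner_linearl L2_inner_ge0 L2_inner_eq0 L2_inner_complete.

Lemma L2_innerP (f g : L2) :
  inner f g = \int[mu]_x (L2fun_of f x * L2fun_of g x).
Proof. by []. Qed.

End L2_space.

Lemma hilbert_complete (R : realType) (V : hilbertType R) (u : nat -> V) :
  (forall e : R, 0 < e -> exists N, forall m n, (N <= m)%N -> (N <= n)%N ->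
     inner (u m - u n) (u m - u n) < e) ->
  exists l, forall e : R, 0 < e -> exists N, forall n, (N <= n)%N ->
     inner (u n - l) (u n - l) < e.
Proof.
have lt_sqr (e : R) (x : V) : 0 < e -> (inner x x < e ^+ 2) = (`|x| < e).
  by move=> e0; rewrite inner_norm ltr_pXn2r ?nnegrE ?(ltW e0).
move=> uc; have /cauchy_cvg/cvg_ex[l ul] : cauchy (u @ \oo).
  apply: cauchy_exP => e e0; have [N NP] := uc _ (exprn_gt0 2 e0).
  exists (u N); exists N => // n /= Nn.
  by rewrite -ball_normE /= -lt_sqr// NP.
exists l => e e0; have se0 : 0 < Num.sqrt e by rewrite sqrtr_gt0.
have /cvgrPdist_lt/(_ _ se0)[N _ NP] := ul.
exists N => n /NP; rewrite /= distrC -lt_sqr// sqr_sqrtr//.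
exact: ltW.
Qed.

Section hilbert_sum.
Context (R : realType) (I : finType) (V : I -> hilbertType R).

(* The Hilbert space direct sum of a finite family, with the norm
   [|x| ^+ 2 = \sum_i |x i| ^+ 2]. *)
Definition hsum : Type := forall i, V i.

HB.instance Definition _ := gen_eqMixin hsum.
HB.instance Definition _ := gen_choiceMixin hsum.

Let hsum_ext (x y : hsum) : (forall i, x i = y i) -> x = y.
Proof. exact: functional_extensionality_dep. Qed.

Let hsum_add (x y : hsum) : hsum := fun i => x i + y i.
Let hsum_opp (x : hsum) : hsum := fun i => - x i.
Let hsum_zero : hsum := fun i => 0.
Let hsum_scale (a : R) (x : hsum) : hsum := fun i => a *: x i.

Let hsum_addA : associative hsum_add.
Proof. by move=> x y z; apply: hsum_ext => i; exact: addrA. Qed.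

Let hsum_addC : commutative hsum_add.
Proof. by move=> x y; apply: hsum_ext => i; exact: addrC. Qed.

Let hsum_add0 : left_id hsum_zero hsum_add.
Proof. by move=> x; apply: hsum_ext => i; exact: add0r. Qed.

Let hsum_addN : left_inverse hsum_zero hsum_opp hsum_add.
Proof. by move=> x; apply: hsum_ext => i; exact: addNr. Qed.

HB.instance Definition _ :=
  GRing.isZmodule.Build hsum hsum_addA hsum_addC hsum_add0 hsum_addN.

Let hsum_scaleA a b x : hsum_scale a (hsum_scale b x) = hsum_scale (a * b) x.
Proof. by apply: hsum_ext => i; exact: scalerA. Qed.

Let hsum_scale1 : left_id 1 hsum_scale.
Proof. by move=> x; apply: hsum_ext => i; exact: scale1r. Qed.

Let hsum_scaleDr : right_distributive hsum_scale +%R.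
Proof. by move=> a x y; apply: hsum_ext => i; exact: scalerDr. Qed.

Let hsum_scaleDl x : {morph hsum_scale^~ x : a b / a + b}.
Proof. by move=> a b; apply: hsum_ext => i; exact: scalerDl. Qed.

HB.instance Definition _ := GRing.Zmodule_isLmodule.Build R hsum
  hsum_scaleA hsum_scale1 hsum_scaleDr hsum_scaleDl.

Let hsum_inner (x y : hsum) : R := \sum_i inner (x i) (y i).

Let hsum_innerC x y : hsum_inner x y = hsum_inner y x.
Proof. by apply: eq_bigr => i _; exact: innerC. Qed.

Let hsum_inner_linearl (a : R) x y z :
  hsum_inner (a *: x + y) z = a * hsum_inner x z + hsum_inner y z.
Proof.
rewrite mulr_sumr -big_split/=; apply: eq_bigr => i _.
exact: inner_linearl.
Qed.

Let inner_ge0 i (x : V i) : 0 <= inner x x.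
Proof. by rewrite inner_norm sqr_ge0. Qed.

Let hsum_inner_ge0 x : 0 <= hsum_inner x x.
Proof. exact: sumr_ge0. Qed.

Let le_hsum_inner i x : inner (x i) (x i) <= hsum_inner x x.
Proof. by rewrite /hsum_inner (bigD1 i)//= lerDl sumr_ge0. Qed.

Let hsum_inner_eq0 x : hsum_inner x x = 0 -> x = 0.
Proof.
move=> x0; apply: hsum_ext => i.
have : inner (x i) (x i) == 0 by rewrite eq_le inner_ge0 andbT -x0.
by rewrite inner_norm sqrf_eq0 normr_eq0 => /eqP.
Qed.

Let hsum_inner_complete (u : nat -> hsum) :
  (forall e : R, 0 < e -> exists N, forall m n, (N <= m)%N -> (N <= n)%N ->
     hsum_inner (u m - u n) (u m - u n) < e) ->
  exists l, forall e : R, 0 < e -> exists N, forall n, (N <= n)%N ->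
     hsum_inner (u n - l) (u n - l) < e.
Proof.
move=> uc.
have ui i : exists l : V i, forall e : R, 0 < e -> exists N,
    forall n, (N <= n)%N -> inner (u n i - l) (u n i - l) < e.
  apply: hilbert_complete => e /uc[N NP]; exists N => m n Nm Nn.
  exact: le_lt_trans (le_hsum_inner i _) (NP _ _ Nm Nn).
exists (fun i => projT1 (cid (ui i))) => e e0.
have c0 : 0 < e / #|I|.+1%:R by rewrite divr_gt0.
have /choice[N_ NP] i := projT2 (cid (ui i)) _ c0.
exists (\max_i N_ i)%N => n Nn.
apply: (@le_lt_trans _ _ (\sum_(i : I) e / #|I|.+1%:R)).
  apply: ler_sum => i _; apply/ltW/NP.
  exact: leq_trans (leq_bigmax i) Nn.
rewrite sumr_const -[ltLHS]mulr_natr mulrAC ltr_pdivrMr// ltr_pM2l// ltr_nat.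
by rewrite ltnS max_card.
Qed.

HB.instance Definition _ := Lmodule_isHilbert.Build R hsum hsum_innerC
  hsum_inner_linearl hsum_inner_ge0 hsum_inner_eq0 hsum_inner_complete.

Lemma hsum_innerP (x y : hsum) : inner x y = \sum_i inner (x i) (y i).
Proof. by []. Qed.

End hilbert_sum.

Definition image_measure d1 d2 (T1 : measurableType d1) (T2 : measurableType d2)
    (R : realType) (mu : {measure set T1 -> \bar R}) (f : T1 -> T2)
    (mf : measurable_fun setT f) : {measure set T2 -> \bar R}.
Proof. by refine (pushforward mu f : {measure set T2 -> \bar R}). Defined.

Lemma image_measureE d1 d2 (T1 : measurableType d1) (T2 : measurableType d2)
    (R : realType) (mu : {measure set T1 -> \bar R}) (f : T1 -> T2)
    (mf : measurable_fun setT f) :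
  image_measure mu mf = pushforward mu f :> (set T2 -> \bar R).
Proof. by []. Qed.

Section lebesgue_measure_rV.
Context (R : realType).

Lemma measurable_tuple_cons d : measurable_fun setT
  (fun x : measurableTypeR R * d.-tuple R => [the d.+1.-tuple R of x.1 :: x.2]).
Proof. exact: measurable_cons. Qed.

Fixpoint lebesgue_tuple (d : nat) : {measure set (d.-tuple R) -> \bar R} :=
  match d with
  | 0 => \d_([tuple] : 0.-tuple R)
  | d'.+1 => image_measure (lebesgue_measure \x^ lebesgue_tuple d')%E
               (@measurable_tuple_cons d')
  end.

(* [R^d] with its Borel sigma-algebra. *)
Definition borel_rV (d : nat) := g_sigma_algebraType (@open 'rV[R]_d).

Lemma measurable_rV_of_tuple d : measurable_fun setT
  (fun t : d.-tuple R => (\row_i tnth t i : borel_rV d)).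
Proof.
apply: (@measurability _ _ _ (borel_rV d) setT _ (@open 'rV[R]_d)) => //.
move=> _ [U oU <-].
rewrite setTI.
pose f (t : d.-tuple R) : 'rV[R]_d := \row_i tnth t i.
pose B (qk : 'rV[rat]_d * nat) : set 'rV[R]_d :=
  ball (map_mx (@ratr R) qk.1) qk.2.+1%:R^-1.
have mB qk : measurable (f @^-1` B qk).
  have -> : f @^-1` B qk = \bigcap_(i in [set: 'I_d])
      ((fun t : d.-tuple R => tnth t i) @^-1`
        ball (ratr (qk.1 ord0 i) : R) qk.2.+1%:R^-1).
    apply/seteqP; split => t /=.
      by move=> [_ tB] i _; have := tB ord0 i; rewrite !mxE.
    move=> tB; split; first by rewrite invr_gt0.
    by move=> i j; rewrite !mxE (ord1 i); exact: tB.
  apply: fin_bigcap_measurable => // i _.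
  rewrite -[X in measurable X]setTI; apply: measurable_tnth => //.
  exact: measurable_ball.
rewrite (_ : _ @^-1` U = \bigcup_qk (if `[< B qk `<=` U >] then f @^-1` B qk else set0)).
  apply: countable_bigcupT_measurable; first exact: countableP.
  by move=> qk; case: ifPn => _; [exact: mB|exact: measurable0].
apply/seteqP; split => t /=; last first.
  by move=> [qk _]; case: ifPn => // /asboolP BU /BU.
move=> Ut; have /nbhs_ballP[e /= e0 eU] : nbhs (f t) U by exact: open_nbhs_nbhs.
pose k := Num.truncn (2 / e).
pose r : R := k.+1%:R^-1.
have r0 : 0 < r by rewrite invr_gt0.
have re : r + r <= e.
  have : 2 / e < k.+1%:R by exact: truncnS_gt.
  rewrite ltr_pdivrMr// => /ltW.
  move=> /(ler_wpM2l (ltW r0)); rewrite mulrA mulVf// mul1r.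
  by rewrite mulr_natr mulr2n.
have /choice[q qP] : forall i : 'I_d, exists q : rat, ball (f t ord0 i) r (ratr q).
  move=> i; have : f t ord0 i - r < f t ord0 i + r.
    by rewrite ltrBlDr -addrA ltrDl addr_gt0.
  move=> /rat_in_itvoo[q]; rewrite in_itv /= => /andP[q1 q2]; exists q.
  by rewrite /ball/= ltr_norml ltrBrDl ltrBlDl; apply/andP; split; lra.
have tB : B (\row_i q i, k) (f t).
  by split => // i j; rewrite !mxE; apply: ball_sym; have := qP j; rewrite mxE.
exists (\row_i q i, k) => //.
case: ifPn => [_ //|/asboolPn[]] y yB; apply: eU.
apply: le_ball re _ _; apply: ball_triangle yB.
exact: ball_sym.
Qed.

Definition lebesgue_rV (d : nat) : {measure set (borel_rV d) -> \bar R} :=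
  image_measure (lebesgue_tuple d) (@measurable_rV_of_tuple d).

End lebesgue_measure_rV.

Section lipschitz_domains.
Context (R : realType) (d : nat).

(* Near every boundary point, after an orthogonal change of coordinates, [A] is
   the strict subgraph of a Lipschitz function of the first [d] coordinates. *)
Definition lipschitz_boundary (A : set 'rV[R]_d.+1) : Prop :=
  forall x, (closure A `\` A°) x ->
  exists (Q : 'M[R]_d.+1) (phi : 'rV[R]_d -> R) (k r : R),
    [/\ Q *m Q^T = 1%:M, k.-lipschitz phi, 0 < r &
        forall y, ball x r y ->
          (A y <-> (y *m Q) ord0 ord_max < phi (col' ord_max (y *m Q)))].

Record lipschitz_domain := LipschitzDomain {
  lipschitz_domain_set :> set 'rV[R]_d.+1;
  lipschitz_domain_nonempty : lipschitz_domain_set !=set0;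
  lipschitz_domain_open : open lipschitz_domain_set;
  lipschitz_domain_connected : connected lipschitz_domain_set;
  lipschitz_domain_boundary : lipschitz_boundary lipschitz_domain_set
}.

Lemma lipschitz_domain_measurable (Omega : lipschitz_domain) :
  measurable ((Omega : set 'rV[R]_d.+1) : set (borel_rV R d.+1)).
Proof. by apply: sub_sigma_algebra; exact: lipschitz_domain_open. Qed.

(* [L^2(Omega; R^m)]: [m]-tuples of scalar classes. A class with respect to the
   restriction of the Lebesgue measure to [Omega] ignores the values taken
   outside [Omega]. *)
Definition L2_domain (Omega : lipschitz_domain) (m : nat) : hilbertType R :=
  hsum (fun _ : 'I_m =>
    L2 (mrestr (lebesgue_rV R d.+1) (lipschitz_domain_measurable Omega))).

End lipschitz_domains.

Definition L2_product (R : realType) (n : nat) (d m : 'I_n -> nat)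
    (Omega : forall j, lipschitz_domain R (d j)) : hilbertType R :=
  hsum (fun j => L2_domain (Omega j) (m j)).

Section operators.
Context (R : realType) (V W : hilbertType R).

Definition bounded_operator (T : V -> W) : Prop :=
  exists M : R, forall x, `|T x| <= M * `|x|.

Definition is_adjoint (T : V -> W) (Tstar : W -> V) : Prop :=
  forall x y, inner (T x) y = inner x (Tstar y).

End operators.

Section least_squares.
Context (R : realType) (H X Y Ystar Z : hilbertType R).
Context (A : Z -> H) (Astar : H -> Z) (B : X -> Z) (Bstar : Z -> X) (C : X -> X).
Context (L I : Y -> Z) (Lstar Istar : Ystar -> Z).

(* As [L] and [Lstar] are bijective, the two defining equations below have a
   unique solution, which [xget] returns. *)
Definition state (u : X) : Y := xget 0 [set y | L y = - B u].

Definition adjoint_state (y : Y) : Ystar :=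
  xget 0 [set p | Lstar p = Astar (A (I y))].

Definition triple_norm (lambda : R) (u : X) (y : Y) (p : Ystar) : R :=
  Num.sqrt (lambda * `|u| ^+ 2 + `|y - state u| ^+ 2
    + lambda^-1 * `|p - adjoint_state y| ^+ 2 + `|A (I (state u))| ^+ 2).

Definition ls_form (lambda alpha beta : R) (u : X) (y : Y) (p : Ystar)
    (v : X) (z : Y) (q : Ystar) : R :=
  alpha * inner (L y + B u) (L z + B v)
  + beta * inner (Lstar p - Astar (A (I y))) (Lstar q - Astar (A (I z)))
  + inner (- Bstar (Istar p) + lambda *: C u) v.

Definition ls_load (alpha beta : R) (f : Z) (zd : H)
    (v : X) (z : Y) (q : Ystar) : R :=
  alpha * inner f (L z + B v)
  + beta * inner (- Astar zd) (Lstar q - Astar (A (I z))).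

Definition vi_solution (a : X -> Y -> Ystar -> X -> Y -> Ystar -> R)
    (l : X -> Y -> Ystar -> R) (W : set (X * Y * Ystar)) (x : X * Y * Ystar) :=
  let: (u, y, p) := x in
  W (u, y, p) /\
  forall v z q, W (v, z, q) ->
    a u y p (v - u) (z - y) (q - p) >= l (v - u) (z - y) (q - p).

Definition optimality_system (lambda : R) (f : Z) (zd : H) (Xad : set X)
    (x : X * Y * Ystar) :=
  let: (u, y, p) := x in
  [/\ Xad u, L y = f - B u, Lstar p = Astar (A (I y) - zd) &
      forall v, Xad v -> 0 <= inner (- Bstar (Istar p) + lambda *: C u) (v - u)].

End least_squares.

(* Main.v *)
Require Import Defs.
From HB Require Import structures.
From mathcomp Require Import all_boot all_order all_algebra.
From mathcomp Require Import all_classical all_reals all_analysis.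
From mathcomp Require Import ring lra.
Set Implicit Arguments.
Unset Strict Implicit.
Unset Printing Implicit Defensive.
Import Order.TTheory GRing.Theory Num.Theory.
Import numFieldNormedType.Exports.
Local Open Scope classical_set_scope.
Local Open Scope ring_scope.

(** Write [S u] for the state [y_u] and [G y] for the adjoint state [p_y]. The
    two least-squares residuals are [L (y - S u)] and [Lstar (p - G y)], so by
    bounded inverses of [L] and [Lstar] they are equivalent to [y - S u] and
    [p - G y]. The symmetry of [L] and [I], with [L (S v) = - B v], turns the
    remaining term of the form into
      [inner (- Bstar (Istar p)) v = inner (I (S v)) (Lstar (p - G y))
         + inner (A (I (S v))) (A (I (S u)))
         + inner (A (I (S v))) (A (I (y - S u)))]
    (lemma [gradient_coupling]). At [v = u] the middle term is the nonnegative
    [`|A (I (S u))| ^+ 2]; the two others are indefinite and are absorbed by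
    Young's inequality. The first one is balanced against
    [lambda * kappa * `|u| ^+ 2], at the cost of a multiple of [lambda^-1] times
    [`|Lstar (p - G y)| ^+ 2], whence a threshold for [beta] of order
    [lambda^-1]; the last one costs a fixed multiple of [`|L (y - S u)| ^+ 2],
    whence a constant threshold for [alpha]. The same identity and
    Cauchy-Schwarz give boundedness.

    For fixed [lambda] the triple norm is equivalent to the Hilbert norm of
    [X * Y * Ystar], so the variational inequality is well posed by Stampacchia's
    theorem for nonsymmetric coercive forms (lemmas [stampacchia] and
    [stampacchia_unique]). On [Xad * Y * Ystar] the state and the adjoint vary
    freely; since [L] and [Lstar] are onto, both residual equations can be
    extracted from the inequality, which is then equivalent to the optimality
    system ([vi_solution_optimality]).

    The functional analysis rests on one minimisation lemma,
    [linear_minimiser]. It gives the Riesz representation theorem ([riesz]), and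
    with the contraction principle the theorem of Stampacchia. The bounded
    inverse theorem ([bounded_inverse]) follows from the uniform boundedness
    principle applied to the adjoint, and Lax-Milgram. *)

(** * Inner products and linear functionals *)

Section hilbert_basics.
Context (R : realType) (V : hilbertType R).
Implicit Types (u v w : V) (k : R).

Lemma innerDl u v w : inner (u + v) w = inner u w + inner v w.
Proof. by have := inner_linearl 1 u v w; rewrite scale1r mul1r. Qed.

Lemma inner0l w : inner 0 w = 0.
Proof. by apply: (addIr (inner 0 w)); rewrite -innerDl addr0 add0r. Qed.

Lemma innerZl k u w : inner (k *: u) w = k * inner u w.
Proof. by have := inner_linearl k u 0 w; rewrite addr0 inner0l addr0. Qed.

Lemma innerNl u w : inner (- u) w = - inner u w.
Proof. by rewrite -scaleN1r innerZl mulN1r. Qed.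

Lemma innerBl u v w : inner (u - v) w = inner u w - inner v w.
Proof. by rewrite innerDl innerNl. Qed.

Lemma innerDr u v w : inner w (u + v) = inner w u + inner w v.
Proof. by rewrite innerC innerDl !(innerC w). Qed.

Lemma inner0r w : inner w 0 = 0.
Proof. by rewrite innerC inner0l. Qed.

Lemma innerZr k u w : inner w (k *: u) = k * inner w u.
Proof. by rewrite innerC innerZl (innerC w). Qed.

Lemma innerNr u w : inner w (- u) = - inner w u.
Proof. by rewrite innerC innerNl (innerC w). Qed.

Lemma innerBr u v w : inner w (u - v) = inner w u - inner w v.
Proof. by rewrite innerDr innerNr. Qed.

Definition innerE :=
  (innerDl, innerDr, innerBl, innerBr, innerNl, innerNr, innerZl, innerZr).

Lemma inner_ge0 u : 0 <= inner u u.
Proof. by rewrite inner_norm sqr_ge0. Qed.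

Lemma cauchy_schwarz u v : `|inner u v| <= `|u| * `|v|.
Proof.
rewrite -(ler_pXn2r (ltn0Sn 1)) ?nnegrE ?mulr_ge0// real_normK ?num_real//.
rewrite exprMn -!inner_norm.
have [->|u0] := eqVneq u 0; first by rewrite !inner0l expr0n mul0r.
have uu : 0 < inner u u by rewrite inner_norm exprn_gt0// normr_gt0.
have := inner_ge0 (v - (inner u v / inner u u) *: u).
have -> : inner (v - (inner u v / inner u u) *: u)
    (v - (inner u v / inner u u) *: u)
  = inner v v - inner u v ^+ 2 / inner u u.
  by rewrite !innerE (innerC v u); field; rewrite gt_eqF.
by rewrite subr_ge0 ler_pdivrMr// mulrC.
Qed.

Lemma inner_inj u v : (forall w, inner u w = inner v w) -> u = v.
Proof.
move=> uv; apply/eqP; rewrite -subr_eq0 -normr_eq0 -sqrf_eq0 -inner_norm.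
by rewrite innerBl uv subrr.
Qed.

Lemma normrB_sqr u v :
  `|u - v| ^+ 2 = `|u| ^+ 2 - 2 * inner u v + `|v| ^+ 2.
Proof. by rewrite -!inner_norm !innerE (innerC v u); ring. Qed.

End hilbert_basics.

Section scalar_maps.
Context (R : realType) (V : lmodType R) (phi : V -> R).
Hypothesis phi_lin : scalar phi.

Lemma scalarD_fun x y : phi (x + y) = phi x + phi y.
Proof. by have := phi_lin 1 x y; rewrite scale1r mul1r. Qed.

Lemma scalar0_fun : phi 0 = 0.
Proof. by apply: (addIr (phi 0)); rewrite -scalarD_fun addr0 add0r. Qed.

Lemma scalarZ_fun k x : phi (k *: x) = k * phi x.
Proof. by have := phi_lin k x 0; rewrite addr0 scalar0_fun addr0. Qed.

Lemma scalarN_fun x : phi (- x) = - phi x.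
Proof. by rewrite -scaleN1r scalarZ_fun mulN1r. Qed.

Lemma scalarB_fun x y : phi (x - y) = phi x - phi y.
Proof. by rewrite scalarD_fun scalarN_fun. Qed.
End scalar_maps.

Lemma convex_set_segment (R : realType) (V : lmodType R) (W : set V) (v w : V)
    (t : R) :
  convex_set W -> W v -> W w -> 0 < t < 1 -> W (w + t *: (v - w)).
Proof.
move=> cW Wv Ww /andP[t0 t1].
have := cW v w (Itv01 (ltW t0) (ltW t1)).
rewrite !inE => /(_ Wv Ww).
rewrite -[X in W X]/(t *: v + (1 - t) *: w); congr W.
by rewrite scalerBr scalerBl scale1r addrCA.
Qed.

(** * Minimisation over a closed convex set, and the Riesz theorem *)

Section minimisation.
Context (R : realType) (V : hilbertType R) (W : set V) (phi : V -> R) (M : R).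
Hypotheses (W0 : W !=set0) (W_closed : closed W) (W_convex : convex_set W).
Hypotheses (phi_lin : scalar phi).
Hypothesis phi_bnd : forall x, `|phi x| <= M * `|x|.

Let J (w : V) : R := `|w| ^+ 2 - 2 * phi w.

Let J_lb w : - M ^+ 2 <= J w.
Proof.
have := phi_bnd w; rewrite /J => /(le_trans (ler_norm _)) h.
have := sqr_ge0 (`|w| - M); rewrite sqrrB; lra.
Qed.

Let has_inf_J : has_inf (J @` W).
Proof.
split; first by case: W0 => w Ww; exists (J w); exists w.
by exists (- M ^+ 2) => _ [w _ <-].
Qed.

Let m := inf (J @` W).

Let m_le w : W w -> m <= J w.
Proof. by move=> Ww; apply: ge_inf; [exact: has_inf_J.2|exists w]. Qed.

Let J_midpoint v w : W v -> W w -> `|v - w| ^+ 2 <= 2 * J v + 2 * J w - 4 * m.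
Proof.
move=> Wv Ww.
have h : 0 < (2^-1 : R) < 1 by rewrite invr_gt0 ltr0n/= invf_lt1// ltr1n.
have := m_le (convex_set_segment W_convex Wv Ww h).
rewrite /J (scalarD_fun phi_lin) (scalarZ_fun phi_lin) (scalarB_fun phi_lin).
rewrite -!inner_norm !innerE (innerC v w).
lra.
Qed.

Let J_near w x : J w <= J x + 2 * (`|w| + M) * `|x - w|.
Proof.
have -> : J x = J w + 2 * inner w (x - w) + `|x - w| ^+ 2 - 2 * phi (x - w).
  rewrite /J -!inner_norm !innerE (scalarB_fun phi_lin) (innerC x w); ring.
have := phi_bnd (x - w) => /(le_trans (ler_norm _)).
have := cauchy_schwarz w (x - w); rewrite ler_norml => /andP[+ _].
have := sqr_ge0 `|x - w|.
rewrite [2 * (_ + _) * _]mulrC mulrCA mulrDr.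
rewrite [`|x - w| * `|w|]mulrC [`|x - w| * M]mulrC.
lra.
Qed.

(** The minimiser [w] of [`|w| ^+ 2 - 2 * phi w] over [W], with its variational
    characterisation. Minimising sequences are Cauchy by the parallelogram
    identity ([J_midpoint]). For [phi = inner x], [w] is the projection of [x]
    on [W]. *)
Lemma linear_minimiser :
  exists2 w, W w & forall v, W v -> phi (v - w) <= inner w (v - w).
Proof.
have /choice[x xP] : forall n : nat, exists x, W x /\ J x < m + n.+1%:R^-1.
  move=> n; have n0 : 0 < n.+1%:R^-1 :> R by rewrite invr_gt0.
  by have [_ [x Wx <-] Jx] := inf_adherent n0 has_inf_J; exists x.
have small (e : R) : 0 < e -> exists N, forall n, (N <= n)%N -> n.+1%:R^-1 < e.
  move=> e0; exists (Num.truncn e^-1) => n Nn.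
  rewrite invf_plt ?posrE// (lt_le_trans (truncnS_gt _))//.
  by rewrite ler_nat.
have [|w wP] := @hilbert_complete R V x.
  move=> e e0; have [N NP] := small (e / 4) (divr_gt0 e0 (ltr0Sn R 3)).
  exists N => i j /NP Ni /NP Nj; rewrite inner_norm.
  apply: le_lt_trans (J_midpoint (xP i).1 (xP j).1) _.
  move: (xP i).2 (xP j).2 Ni Nj.
  by move: (J (x i)) (J (x j)) (i.+1%:R^-1) (j.+1%:R^-1) => *; lra.
have xw (e : R) : 0 < e -> exists N, forall n, (N <= n)%N -> `|x n - w| < e.
  move=> e0; have [N NP] := wP _ (exprn_gt0 2 e0); exists N => n /NP.
  by rewrite inner_norm ltr_pXn2r ?nnegrE ?(ltW e0).
have Ww : W w.
  apply: (@closed_cvg _ _ \oo _ x W W_closed) => //.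
    by apply: nearW => n; exact: (xP n).1.
  apply/cvgrPdist_lt => e /xw[N NP]; exists N => // n /NP.
  by rewrite distrC.
have Jw : J w <= m.
  apply/ler_addgt0Pr => e e0.
  have K0 : 0 < `|2 * (`|w| + M)| + 1 by rewrite ltr_wpDl.
  have [N1 N1P] := small _ (divr_gt0 e0 (ltr0Sn R 1)).
  have [N2 N2P] := xw _ (divr_gt0 (divr_gt0 e0 (ltr0Sn R 1)) K0).
  pose n := maxn N1 N2.
  have := J_near w (x n); have := (xP n).2.
  have := N1P n (leq_maxl _ _).
  have : 2 * (`|w| + M) * `|x n - w| <= e / 2.
    have := N2P n (leq_maxr _ _); rewrite ltr_pdivlMr// => /ltW.
    apply: le_trans; rewrite [leRHS]mulrC ler_wpM2r//.
    by rewrite (le_trans (ler_norm _))// lerDl.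
  move: (J (x n)) (2 * _ * _) (n.+1%:R^-1) => *; lra.
(* Move from [w] towards [v] by a step [t] so small that the quadratic term
   [t * `|v - w| ^+ 2] is at most [e]. *)
exists w => // v Wv.
have seg t : 0 < t < 1 -> m <= J (w + t *: (v - w)).
  by move=> t01; exact: m_le (convex_set_segment W_convex Wv Ww t01).
move: (v - w) seg => z seg; rewrite -subr_le0.
apply/ler_addgt0Pr => e e0; rewrite add0r.
pose t := Num.min (2^-1) (e / (`|z| ^+ 2 + 1)).
have z0 : 0 < `|z| ^+ 2 + 1 by rewrite ltr_wpDl// sqr_ge0.
have t0 : 0 < t by rewrite lt_min invr_gt0 ltr0n divr_gt0.
have t1 : t < 1 by rewrite gt_min invf_lt1// ltr1n.
have tz : t * `|z| ^+ 2 <= e.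
  apply: (@le_trans _ _ (t * (`|z| ^+ 2 + 1))).
    by rewrite ler_wpM2l ?(ltW t0)// lerDl.
  by rewrite -ler_pdivlMr// ge_min lexx orbT.
have := seg t; rewrite t0 t1 => /(_ isT) /(le_trans Jw).
rewrite /J (scalarD_fun phi_lin) (scalarZ_fun phi_lin) -!inner_norm !innerE.
rewrite (innerC z w) => h.
have : 0 <= t * (2 * (inner w z - phi z) + t * inner z z).
  by move: h; lra.
rewrite pmulr_rge0// inner_norm; lra.
Qed.

End minimisation.

Lemma convex_setT (R : realType) (V : lmodType R) : convex_set [set: V].
Proof. by move=> x y t _ _; rewrite in_setT. Qed.

Lemma riesz (R : realType) (V : hilbertType R) (phi : V -> R) (M : R) :
  scalar phi -> (forall x, `|phi x| <= M * `|x|) ->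
  exists h, forall v, inner h v = phi v.
Proof.
move=> phi_lin phi_bnd.
have [h _ hP] := linear_minimiser (ex_intro _ 0 I) closedT
  (@convex_setT R V) phi_lin phi_bnd.
exists h => v; apply/eqP; rewrite eq_le; apply/andP; split.
  have := hP (h - v) I; rewrite addrAC subrr add0r innerNr (scalarN_fun phi_lin).
  by rewrite lerN2.
by have := hP (h + v) I; rewrite addrAC subrr add0r.
Qed.

(** * Stampacchia's theorem *)

Section stampacchia.
Context (R : realType) (V : hilbertType R) (W : set V).
Context (a : V -> V -> R) (l : V -> R) (M N c : R).
Hypotheses (W0 : W !=set0) (W_closed : closed W) (W_convex : convex_set W).
Hypotheses (a_linl : forall v, scalar (a^~ v)) (a_linr : forall u, scalar (a u)).
Hypothesis a_bnd : forall u v, `|a u v| <= M * `|u| * `|v|.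
Hypotheses (c_gt0 : 0 < c) (a_coer : forall u, c * `|u| ^+ 2 <= a u u).
Hypotheses (l_lin : scalar l) (l_bnd : forall v, `|l v| <= N * `|v|).

(* Adding [c] makes [c <= K], so that [q2] below is nonnegative. *)
Let K : R := `|M| + c.
Let K_gt0 : 0 < K. Proof. by rewrite ltr_wpDl. Qed.
(* This step size minimises [1 - 2 * rho * c + (rho * K) ^+ 2]; the minimum is
   [q2], the square of the contraction factor. *)
Let rho : R := c / K ^+ 2.
Let rho_gt0 : 0 < rho. Proof. by rewrite divr_gt0// exprn_gt0. Qed.
Let q2 : R := 1 - (c / K) ^+ 2.
Let q2_ge0 : 0 <= q2.
Proof.
rewrite subr_ge0 expr_le1// ?divr_ge0 ?(ltW c_gt0) ?(ltW K_gt0)//.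
by rewrite ler_pdivrMr// mul1r /K lerDr.
Qed.
Let q2_lt1 : q2 < 1.
Proof. by rewrite ltrBlDr ltrDl exprn_gt0// divr_gt0. Qed.

Let a_bndK u v : `|a u v| <= K * `|u| * `|v|.
Proof.
apply: le_trans (a_bnd u v) _; rewrite !ler_wpM2r//.
by rewrite (le_trans (ler_norm _))// lerDl ltW.
Qed.

Let F (u v : V) : R := inner u v - rho * (a u v - l v).

Let F_lin u : scalar (F u).
Proof. by move=> k x y; rewrite /F a_linr l_lin innerDr innerZr; ring. Qed.

Let F_bnd u v : `|F u v| <= (`|u| + rho * (K * `|u| + N)) * `|v|.
Proof.
have h1 := cauchy_schwarz u v; have h2 := a_bndK u v; have h3 := l_bnd v.
rewrite /F (le_trans (ler_normB _ _))// mulrDl lerD// normrM gtr0_norm//.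
rewrite -[leRHS]mulrA ler_wpM2l ?(ltW rho_gt0)// (le_trans (ler_normB _ _))//.
by rewrite mulrDl lerD.
Qed.

(* [h] is the Riesz representative of [a d], so [d - rho *: h] is one step of
   the damped iteration applied to [d]. *)
Let damped_norm d h : (forall v, inner h v = a d v) ->
  `|d - rho *: h| <= Num.sqrt q2 * `|d|.
Proof.
move=> hP.
have hK : `|h| <= K * `|d|.
  have [->|h0] := eqVneq h 0; first by rewrite normr0 mulr_ge0 ?(ltW K_gt0).
  rewrite -(ler_pM2r (_ : 0 < `|h|)) ?normr_gt0// -expr2 -inner_norm hP.
  exact: le_trans (ler_norm _) (a_bndK _ _).
rewrite -(ler_pXn2r (ltn0Sn 1)) ?nnegrE ?mulr_ge0 ?sqrtr_ge0//.
rewrite exprMn sqr_sqrtr// normrB_sqr innerZr (innerC d) hP normrZ exprMn.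
rewrite (gtr0_norm rho_gt0).
have h2 : `|h| ^+ 2 <= K ^+ 2 * `|d| ^+ 2.
  by rewrite -exprMn ler_pXn2r ?nnegrE ?mulr_ge0 ?(ltW K_gt0).
have := ler_wpM2l (sqr_ge0 rho) h2.
have := ler_wpM2l (ltW rho_gt0) (a_coer d).
have -> : q2 * `|d| ^+ 2 = `|d| ^+ 2 - 2 * (rho * (c * `|d| ^+ 2))
    + rho ^+ 2 * (K ^+ 2 * `|d| ^+ 2).
  by rewrite /q2 /rho; field; rewrite gt_eqF.
lra.
Qed.

(** The solution is the fixed point of the contraction [T], where [T x] is the
    projection on [W] of the Riesz representative of [F x]. No symmetry of [a] is
    assumed. *)
Lemma stampacchia : exists2 u, W u & forall v, W v -> l (v - u) <= a u (v - u).
Proof.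
have /choice[T TP] : forall u, exists w,
    W w /\ forall v, W v -> F u (v - w) <= inner w (v - w).
  move=> u; have [w Ww wP] := linear_minimiser W0 W_closed W_convex (@F_lin u)
    (F_bnd u).
  by exists w.
have TW : set_fun W W T by move=> u _; exact: (TP u).1.
pose f : {fun W >-> W} := mkfun_fun TW.
have T_key u v (e := T u - T v) :
    `|e| ^+ 2 <= inner (u - v) e - rho * a (u - v) e.
  have Tu : inner (T u) e <= F u e.
    have := (TP u).2 _ (TP v).1; rewrite -[T v - T u]opprB.
    by rewrite (scalarN_fun (F_lin u)) innerNr lerN2.
  have Tv : F v e <= inner (T v) e by exact: (TP v).2 _ (TP u).1.
  have -> : inner (u - v) e - rho * a (u - v) e = F u e - F v e.
    by rewrite (scalarB_fun (a_linl e)) innerBl /F; ring.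
  by rewrite -inner_norm innerBl lerB.
have f_lip u v : `|T u - T v| <= Num.sqrt q2 * `|u - v|.
  have [h hP] := riesz (a_linr (u - v)) (a_bndK (u - v)).
  have [->|e0] := eqVneq (T u - T v) 0.
    by rewrite normr0 mulr_ge0// sqrtr_ge0.
  apply: le_trans (damped_norm hP).
  rewrite -(ler_pM2r (_ : 0 < `|T u - T v|)) ?normr_gt0// -expr2.
  apply: le_trans (T_key u v) (le_trans (ler_norm _) _).
  by rewrite -hP -innerZl -innerBl cauchy_schwarz.
have f_contr : is_contraction f.
  exists (NngNum (sqrtr_ge0 q2)); split => /=.
    by rewrite -(ltr_pXn2r (ltn0Sn 1)) ?nnegrE ?sqrtr_ge0// sqr_sqrtr// expr1n.
  by move=> [u v] _ /=; exact: f_lip.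
have [u Wu uf] := banach_fixed_point f_contr W_closed W0.
exists u => // v Wv.
have := (TP u).2 v Wv; rewrite -[T u]/(f u) -uf /F lerBlDl.
rewrite -lerBlDr subrr pmulr_rge0// subr_ge0//.
Qed.

Lemma stampacchia_unique u v : W u -> W v ->
  (forall w, W w -> l (w - u) <= a u (w - u)) ->
  (forall w, W w -> l (w - v) <= a v (w - v)) -> u = v.
Proof.
move=> Wu Wv /(_ _ Wv) hu /(_ _ Wu) hv.
apply/eqP; rewrite -subr_eq0 -normr_eq0 -sqrf_eq0; apply/eqP/le_anti.
rewrite sqr_ge0 andbT -(ler_pM2l c_gt0) mulr0 (le_trans (a_coer _))//.
rewrite (scalarB_fun (a_linl _)); move: hu hv.
rewrite -[v - u]opprB (scalarN_fun (a_linr _)) (scalarN_fun l_lin); lra.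
Qed.

End stampacchia.

(** * Bounded operators, adjoints and the bounded inverse theorem *)

Section bounded_operators.
Context (R : realType) (V W : hilbertType R).
Implicit Types (T : {linear V -> W}) (Ts : W -> V).

Lemma bounded_operator_pos T :
  bounded_operator T -> exists2 M : R, 0 < M & forall x, `|T x| <= M * `|x|.
Proof.
move=> [M TM]; exists (`|M| + 1) => [|x]; first by rewrite ltr_wpDl.
rewrite (le_trans (TM x))// ler_wpM2r// (le_trans (ler_norm M))//.
by rewrite lerDl.
Qed.

Lemma adjoint_exists T :
  bounded_operator T -> exists Ts : W -> V, is_adjoint T Ts.
Proof.
move=> [M TM].
suff /choice[Ts TsP] : forall w, exists h, forall v, inner h v = inner (T v) w.
  by exists Ts => v w; rewrite [RHS]innerC TsP.
move=> w.
have lin : scalar (fun v => inner (T v) w).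
  by move=> k x y; rewrite linearP inner_linearl.
apply: (riesz (M := M * `|w|) lin) => v.
by rewrite (le_trans (cauchy_schwarz _ _))// mulrAC ler_wpM2r.
Qed.

Lemma adjoint_linear T Ts (k : R) x y :
  is_adjoint T Ts -> Ts (k *: x + y) = k *: Ts x + Ts y.
Proof.
move=> TTs; apply: inner_inj => v.
by rewrite inner_linearl ![inner _ v]innerC -!TTs innerDr innerZr.
Qed.

Lemma adjoint_bound T Ts (M : R) :
  is_adjoint T Ts -> (forall x, `|T x| <= M * `|x|) -> 0 <= M ->
  forall y, `|Ts y| <= M * `|y|.
Proof.
move=> TTs TM M0 y; have [->|y0] := eqVneq (Ts y) 0.
  by rewrite normr0 mulr_ge0.
rewrite -(ler_pM2r (_ : 0 < `|Ts y|)) ?normr_gt0// -expr2 -inner_norm -TTs.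
rewrite (le_trans (ler_norm _))// (le_trans (cauchy_schwarz _ _))//.
by rewrite mulrAC ler_wpM2r.
Qed.

End bounded_operators.

Section bounded_inverse.
Context (R : realType) (Y Z : hilbertType R) (L : {linear Y -> Z}).
Hypotheses (L_bnd : bounded_operator L) (L_bij : bijective L).

(** The functionals [inner z] with [`|Lt z| <= 1] are bounded at each point
    [L y], by [`|y|], hence uniformly bounded since [L] is onto. *)
Lemma adjoint_bounded_below (Lt : Z -> Y) : is_adjoint L Lt ->
  exists2 M : R, 0 < M & forall z, `|z| <= M * `|Lt z|.
Proof.
move=> LtP; have [Li LK LiK] := L_bij.
have Lt0 : Lt 0 = 0.
  by apply: inner_inj => y; rewrite innerC -LtP inner0r inner0l.
have LtZ k z : Lt (k *: z) = k *: Lt z.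
  by have := adjoint_linear k z 0 LtP; rewrite Lt0 !addr0.
pose G := [set f : Z -> R^o | exists2 z, `|Lt z| <= 1 & f = inner z].
have G_lin f : G f -> bounded_fun_norm f /\ linear f.
  move=> [z _ ->]; split => [r|k x y]; last by rewrite innerDr innerZr.
  exists (`|z| * r) => x xr; apply: le_trans (cauchy_schwarz _ _) _.
  by rewrite ler_wpM2l.
have G_ptws : pointwise_bounded G.
  move=> x; exists `|Li x| => _ [z z1 ->].
  rewrite -[x in inner z x]LiK innerC LtP.
  by rewrite (le_trans (cauchy_schwarz _ _))// ler_piMr.
have [M MP] := Banach_Steinhauss G_lin G_ptws 1.
have unit_bnd z : `|Lt z| <= 1 -> `|z| <= `|M|.
  move=> z1; have [->|z0] := eqVneq z 0; first by rewrite normr0.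
  have zn : 0 < `|z| by rewrite normr_gt0.
  have Gz : G (inner z) by exists z.
  have := MP _ Gz (`|z|^-1 *: z).
  rewrite normrZ normfV normr_id mulVf ?gt_eqF// lexx => /(_ isT).
  rewrite innerZr inner_norm expr2 mulrA mulVf ?gt_eqF// mul1r normr_id.
  by move=> /le_trans; apply; exact: ler_norm.
exists (`|M| + 1) => [|z]; first by rewrite ltr_wpDl.
have [z0|z0] := eqVneq (Lt z) 0.
  have -> : z = 0.
    by apply: inner_inj => x; rewrite inner0l innerC -[x]LiK LtP z0 innerC inner0l.
  by rewrite normr0 mulr_ge0.
have n0 : 0 < `|Lt z| by rewrite normr_gt0.
have := unit_bnd (`|Lt z|^-1 *: z).
rewrite LtZ !normrZ !normfV !normr_id mulVf ?gt_eqF// lexx => /(_ isT).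
rewrite mulrC ler_pdivrMr// => /le_trans; apply.
by rewrite ler_wpM2r// lerDl.
Qed.

(** Lax-Milgram for [inner (Lt z) (Lt w)], with [Lt] the adjoint of [L], yields
    [z] with [L (Lt z) = L y]. Hence [y = Lt z], and
    [`|y| ^+ 2 = inner (L y) z <= `|L y| * (m * `|y|)]. *)
Lemma bounded_inverse : exists2 m : R, 0 < m & forall y, `|y| <= m * `|L y|.
Proof.
have [Lt LtP] := adjoint_exists L_bnd.
have [m m0 mP] := adjoint_bounded_below LtP.
have [N N0 LN] := bounded_operator_pos L_bnd.
have LtN := adjoint_bound LtP LN (ltW N0).
have LtL k z w : Lt (k *: z + w) = k *: Lt z + Lt w by exact: adjoint_linear LtP.
exists m => // y.
pose a z w := inner (Lt z) (Lt w); pose l w := inner y (Lt w).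
have [w|z|z w||z||w|z _ zP] := @stampacchia R Z setT a l
    (N ^+ 2) (`|y| * N) (m ^- 2) (ex_intro _ 0 I) closedT (@convex_setT R Z).
- by move=> k x w'; rewrite /a LtL inner_linearl.
- by move=> k x w'; rewrite /a LtL innerDr innerZr.
- rewrite /a (le_trans (cauchy_schwarz _ _))//.
  by rewrite expr2 -mulrA mulrACA ler_pM.
- by rewrite invr_gt0 exprn_gt0.
- rewrite /a inner_norm ler_pdivrMl ?exprn_gt0// -exprMn.
  by rewrite ler_pXn2r ?nnegrE// mulr_ge0// ltW.
- by move=> k x w'; rewrite /l LtL innerDr innerZr.
- rewrite /l (le_trans (cauchy_schwarz _ _))// -mulrA ler_wpM2l//.
have Lz : Lt z = y.
  apply: (bij_inj L_bij); apply: inner_inj => w; rewrite !LtP.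
  apply/eqP; rewrite eq_le; apply/andP; split.
    have := zP (z - w) I; rewrite addrAC subrr add0r /a /l -!LtP !innerNr.
    by rewrite lerN2.
  by have := zP (z + w) I; rewrite addrAC subrr add0r /a /l -!LtP.
have [->|y0] := eqVneq y 0; first by rewrite normr0 mulr_ge0// ltW.
rewrite -(ler_pM2r (_ : 0 < `|y|)) ?normr_gt0// -expr2 -inner_norm.
rewrite -{2}Lz -LtP (le_trans (ler_norm _))// (le_trans (cauchy_schwarz _ _))//.
by rewrite mulrC mulrAC ler_wpM2r// -[in leRHS]Lz.
Qed.

End bounded_inverse.

(** * The product of two Hilbert spaces *)

Lemma contracting_continuous (R : realType) (U V : normedModType R) (f : U -> V) :
  (forall x y, `|f x - f y| <= `|x - y|) -> continuous f.
Proof.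
move=> f_le x; apply/cvgrPdist_lt => e e0; near=> y.
by apply: le_lt_trans (f_le x y) _; near: y; exact: cvgr_dist_lt.
Unshelve. all: by end_near. Qed.

Lemma pair_continuous (S T U : topologicalType) (f : S -> T) (g : S -> U) :
  continuous f -> continuous g -> continuous (fun x => (f x, g x)).
Proof. by move=> fc gc x; apply: cvg_pair; [exact: fc|exact: gc]. Qed.

Section hilbert_product.
Context (R : realType) (V W : hilbertType R).

(** The product with the norm [`|x| ^+ 2 = `|x.1| ^+ 2 + `|x.2| ^+ 2]. It is an
    alias of [V * W], which carries the maximum norm by default. *)
Definition hprod : Type := (V * W)%type.

HB.instance Definition _ := GRing.Lmodule.copy hprod (V * W)%type.

Let hprod_inner (x y : hprod) : R := inner x.1 y.1 + inner x.2 y.2.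

Let hprod_innerC x y : hprod_inner x y = hprod_inner y x.
Proof. by rewrite /hprod_inner innerC [inner x.2 _]innerC. Qed.

Let hprod_inner_linearl (k : R) x y z :
  hprod_inner (k *: x + y) z = k * hprod_inner x z + hprod_inner y z.
Proof. by rewrite /hprod_inner/= !inner_linearl; ring. Qed.

Let hprod_inner_ge0 x : 0 <= hprod_inner x x.
Proof. by rewrite addr_ge0 ?inner_ge0. Qed.

Let hprod_inner_eq0 x : hprod_inner x x = 0 -> x = 0.
Proof.
case: x => v w /eqP; rewrite paddr_eq0 ?inner_ge0//=.
by rewrite !inner_norm !sqrf_eq0 !normr_eq0 => /andP[/eqP-> /eqP->].
Qed.

Let hprod_inner_complete (u : nat -> hprod) :
  (forall e : R, 0 < e -> exists N, forall m n, (N <= m)%N -> (N <= n)%N ->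
     hprod_inner (u m - u n) (u m - u n) < e) ->
  exists l, forall e : R, 0 < e -> exists N, forall n, (N <= n)%N ->
     hprod_inner (u n - l) (u n - l) < e.
Proof.
move=> uc.
have [|l1 l1P] := @hilbert_complete R V (fun n => (u n).1).
  move=> e /uc[N NP]; exists N => m n Nm Nn.
  by apply: le_lt_trans (NP m n Nm Nn); rewrite lerDl inner_ge0.
have [|l2 l2P] := @hilbert_complete R W (fun n => (u n).2).
  move=> e /uc[N NP]; exists N => m n Nm Nn.
  by apply: le_lt_trans (NP m n Nm Nn); rewrite lerDr inner_ge0.
exists (l1, l2) => e e0; have e2 : 0 < e / 2 by rewrite divr_gt0.
have [N1 N1P] := l1P _ e2; have [N2 N2P] := l2P _ e2.
exists (maxn N1 N2) => n; rewrite geq_max => /andP[/N1P n1 /N2P n2].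
by rewrite [e]splitr ltrD.
Qed.

HB.instance Definition _ := Lmodule_isHilbert.Build R hprod
  hprod_innerC hprod_inner_linearl hprod_inner_ge0 hprod_inner_eq0
  hprod_inner_complete.

Lemma hprod_norm_sqr (x : hprod) : `|x| ^+ 2 = `|x.1| ^+ 2 + `|x.2| ^+ 2.
Proof. by rewrite -!inner_norm. Qed.

Lemma hprod_norm_fst (x : hprod) : `|x.1| <= `|x|.
Proof.
by rewrite -(ler_pXn2r (ltn0Sn 1)) ?nnegrE// hprod_norm_sqr lerDl sqr_ge0.
Qed.

Lemma hprod_norm_snd (x : hprod) : `|x.2| <= `|x|.
Proof.
by rewrite -(ler_pXn2r (ltn0Sn 1)) ?nnegrE// hprod_norm_sqr lerDr sqr_ge0.
Qed.

Lemma hprod_fst_continuous : continuous (fun x : hprod => x.1).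
Proof.
by apply: contracting_continuous => x y; exact: (hprod_norm_fst (x - y)).
Qed.

Lemma hprod_snd_continuous : continuous (fun x : hprod => x.2).
Proof.
by apply: contracting_continuous => x y; exact: (hprod_norm_snd (x - y)).
Qed.

End hilbert_product.

(** The topologies of the maximum norm and of the Hilbert norm agree; only this
    consequence is needed. *)
Lemma hprod3_closed (R : realType) (X Y P : hilbertType R)
    (W : set (X * Y * P)) :
  closed W -> closed (W : set (hprod (hprod X Y) P)).
Proof.
pose g (x : hprod (hprod X Y) P) : X * Y * P := (x.1.1, x.1.2, x.2).
have g_cont : continuous g.
  have fst_cont := @hprod_fst_continuous R (hprod X Y) P.
  apply: pair_continuous; last exact: hprod_snd_continuous.
  apply: pair_continuous => x; apply: (continuous_comp (@fst_cont x)).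
    exact: hprod_fst_continuous.
  exact: hprod_snd_continuous.
move=> Wc; have -> : (W : set (hprod (hprod X Y) P)) = g @^-1` W.
  by apply/seteqP; split => -[[u y] p].
by apply: preimage_closed => // x _; exact: g_cont.
Qed.

(** * The least-squares form *)

Section least_squares_estimates.
Context (R : realType) (H X Y P Z : hilbertType R).
Context (A : {linear Z -> H}) (As : {linear H -> Z}) (B : {linear X -> Z})
  (Bs : {linear Z -> X}) (C : {linear X -> X}) (L I : {linear Y -> Z})
  (Ls Is : {linear P -> Z}).
Hypotheses (A_adjoint : is_adjoint A As) (B_adjoint : is_adjoint B Bs).
Hypotheses (L_bij : bijective L) (Ls_bij : bijective Ls).
Hypothesis L_I_symmetry : forall y p, inner (L y) (Is p) = inner (I y) (Ls p).
Context (kappa mL mLs kL kLs kA kC kI kS kG : R).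
Hypothesis kappa_gt0 : 0 < kappa.
Hypothesis C_coercive : forall u, inner (C u) u >= kappa * `|u| ^+ 2.
Hypotheses (mL_gt0 : 0 < mL) (mLs_gt0 : 0 < mLs) (kL_gt0 : 0 < kL)
  (kLs_gt0 : 0 < kLs) (kA_gt0 : 0 < kA) (kC_gt0 : 0 < kC) (kI_gt0 : 0 < kI)
  (kS_gt0 : 0 < kS) (kG_gt0 : 0 < kG).
Notation S := (state B L).
Notation G := (adjoint_state A As I Ls).
Hypotheses (L_below : forall y, `|y| <= mL * `|L y|)
  (Ls_below : forall p, `|p| <= mLs * `|Ls p|)
  (L_bnd : forall y, `|L y| <= kL * `|y|)
  (Ls_bnd : forall p, `|Ls p| <= kLs * `|p|)
  (AI_bnd : forall y, `|A (I y)| <= kA * `|y|)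
  (C_bnd : forall u, `|C u| <= kC * `|u|)
  (IS_bnd : forall u, `|I (S u)| <= kI * `|u|)
  (S_bnd : forall u, `|S u| <= kS * `|u|)
  (G_bnd : forall y, `|G y| <= kG * `|y|).

Let a := ls_form A As B Bs C L I Ls Is.
Let l := ls_load A As B L I Ls.
Let norm := triple_norm A As B L I Ls.

Lemma stateE u : L (S u) = - B u.
Proof.
have [g Lg gL] := L_bij.
by apply: (xgetPex 0 (P := [set y | L y = - B u])); exists (g (- B u)) => /=.
Qed.

Lemma adjoint_stateE y : Ls (G y) = As (A (I y)).
Proof.
have [g Lg gL] := Ls_bij.
apply: (xgetPex 0 (P := [set p | Ls p = As (A (I y))])).
by exists (g (As (A (I y)))) => /=.
Qed.

Lemma state_residual u y : L y + B u = L (y - S u).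
Proof. by rewrite linearB stateE opprK. Qed.

Lemma adjoint_residual y p : Ls p - As (A (I y)) = Ls (p - G y).
Proof. by rewrite linearB adjoint_stateE. Qed.

(** The key identity: moving [B] to the left and using [B v = - L (S v)] and the
    symmetry of [L] and [I] gives [inner (I (S v)) (Ls p)], in which [Ls p] is
    split as [Ls (p - G y)] plus [As (A (I y))], and [y] as [S u + (y - S u)]. *)
Lemma gradient_coupling u y p v :
  inner (- Bs (Is p)) v
  = inner (I (S v)) (Ls (p - G y)) + inner (A (I (S v))) (A (I (S u)))
    + inner (A (I (S v))) (A (I (y - S u))).
Proof.
rewrite innerNl innerC -B_adjoint -innerNl -stateE L_I_symmetry.
rewrite !linearB/= adjoint_stateE !innerBr !A_adjoint.
ring.
Qed.

Lemma ls_formE (lambda alpha beta : R) u y p v z q :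
  a lambda alpha beta u y p v z q =
  alpha * inner (L (y - S u)) (L (z - S v))
  + beta * inner (Ls (p - G y)) (Ls (q - G z))
  + lambda * inner (C u) v
  + (inner (I (S v)) (Ls (p - G y)) + inner (A (I (S v))) (A (I (S u)))
    + inner (A (I (S v))) (A (I (y - S u)))).
Proof.
rewrite /a /ls_form !state_residual !adjoint_residual innerDl innerZl.
by rewrite (gradient_coupling u y); ring.
Qed.

Lemma triple_norm_sqr (lambda : R) u y p : 0 < lambda ->
  norm lambda u y p ^+ 2 = lambda * `|u| ^+ 2 + `|y - S u| ^+ 2
    + lambda^-1 * `|p - G y| ^+ 2 + `|A (I (S u))| ^+ 2.
Proof.
move=> l0; apply: sqr_sqrtr.
by rewrite !addr_ge0 ?mulr_ge0 ?sqr_ge0 ?invr_ge0 ?(ltW l0).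
Qed.

Lemma triple_norm_ge0 (lambda : R) u y p : 0 <= norm lambda u y p.
Proof. exact: sqrtr_ge0. Qed.

Lemma triple_norm_components (lambda : R) u y p : 0 < lambda ->
  [/\ Num.sqrt lambda * `|u| <= norm lambda u y p,
      `|y - S u| <= norm lambda u y p,
      `|p - G y| <= Num.sqrt lambda * norm lambda u y p &
      `|A (I (S u))| <= norm lambda u y p].
Proof.
move=> l0; have N0 := triple_norm_ge0 lambda u y p.
have E := triple_norm_sqr u y p l0.
have h1 : 0 <= lambda * `|u| ^+ 2 by rewrite mulr_ge0 ?sqr_ge0// ltW.
have h2 := sqr_ge0 `|y - S u|; have h4 := sqr_ge0 `|A (I (S u))|.
have h3 : 0 <= lambda^-1 * `|p - G y| ^+ 2.
  by rewrite mulr_ge0 ?sqr_ge0// invr_ge0 ltW.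
have s0 : 0 <= Num.sqrt lambda by exact: sqrtr_ge0.
have s2 : Num.sqrt lambda ^+ 2 = lambda by rewrite sqr_sqrtr// ltW.
split; rewrite -(ler_pXn2r (ltn0Sn 1)) ?nnegrE ?mulr_ge0// ?exprMn ?s2.
- by rewrite E; lra.
- by rewrite E; lra.
- by rewrite -ler_pdivrMl// E; lra.
- by rewrite E; lra.
Qed.

(** The thresholds: [alpha0] is [alpha_min] and [beta0] is
    [beta_min * lambda^-1]. In both sums the first summand keeps the squared
    error and the second one absorbs an indefinite term. *)
Definition alpha_min := mL ^+ 2 + (kA * mL) ^+ 2 / 2.
Definition beta_min := mLs ^+ 2 + kI ^+ 2 / (2 * kappa).

Lemma alpha_min_gt0 : 0 < alpha_min.
Proof. by rewrite ltr_wpDr ?exprn_gt0// divr_ge0// sqr_ge0. Qed.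

Lemma beta_min_gt0 : 0 < beta_min.
Proof.
rewrite ltr_wpDr ?exprn_gt0// divr_ge0 ?sqr_ge0// mulr_ge0//.
exact: ltW.
Qed.

Lemma ls_form_coercive (lambda alpha beta : R) u y p : 0 < lambda ->
  alpha_min <= alpha -> beta_min * lambda^-1 <= beta ->
  norm lambda u y p ^+ 2 <= (2 + 2 / kappa) * a lambda alpha beta u y p u y p.
Proof.
move=> l0 alphaP betaP; rewrite triple_norm_sqr// ls_formE !inner_norm.
have cC : lambda * (kappa * `|u| ^+ 2) <= lambda * inner (C u) u.
  by rewrite ler_wpM2l// ltW.
have c1 : - (kI * `|u| * `|Ls (p - G y)|) <= inner (I (S u)) (Ls (p - G y)).
  have := cauchy_schwarz (I (S u)) (Ls (p - G y)).
  rewrite ler_norml => /andP[+ _]; apply: le_trans.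
  by rewrite lerN2 ler_wpM2r.
have c2 : - (`|A (I (S u))| * (kA * mL * `|L (y - S u)|))
    <= inner (A (I (S u))) (A (I (y - S u))).
  have := cauchy_schwarz (A (I (S u))) (A (I (y - S u))).
  rewrite ler_norml => /andP[+ _]; apply: le_trans.
  rewrite lerN2 ler_wpM2l// (le_trans (AI_bnd _))// -mulrA.
  by rewrite ler_wpM2l// ltW.
have w2 : `|y - S u| ^+ 2 <= mL ^+ 2 * `|L (y - S u)| ^+ 2.
  by rewrite -exprMn ler_pXn2r ?nnegrE// mulr_ge0// ltW.
have r2 : `|p - G y| ^+ 2 <= mLs ^+ 2 * `|Ls (p - G y)| ^+ 2.
  by rewrite -exprMn ler_pXn2r ?nnegrE// mulr_ge0// ltW.
have := sqr_ge0 `|p - G y|; have := sqr_ge0 `|y - S u|.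
move: (inner (C u) u) (inner (I (S u)) _) (inner (A (I (S u))) _)
  (sqr_ge0 `|A (I (S u))|) cC c1 c2 w2 r2.
move: `|u| (sqr_ge0 `|u|) `|A (I (S u))|  `|y - S u| `|L (y - S u)|
  `|p - G y| `|Ls (p - G y)|.
move=> nu nu2 g w lw r lr iC iI iA g2 cC c1 c2 w2 r2 w0 r0.
(* Young's inequality for the two indefinite terms. *)
have y1 : kI * nu * lr <= lambda * kappa / 2 * nu ^+ 2
    + kI ^+ 2 / (2 * kappa) * lambda^-1 * lr ^+ 2.
  rewrite -subr_ge0.
  rewrite (_ : _ - _ = (lambda * kappa * nu - kI * lr) ^+ 2
      / (2 * (lambda * kappa))).
    by rewrite divr_ge0 ?sqr_ge0// !mulr_ge0// ltW.
  by field; rewrite !gt_eqF.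
have y2 : g * (kA * mL * lw) <= g ^+ 2 / 2 + (kA * mL) ^+ 2 / 2 * lw ^+ 2.
  by have := sqr_ge0 (g - kA * mL * lw); lra.
have aP := ler_wpM2r (sqr_ge0 lw) alphaP.
have bP := ler_wpM2r (sqr_ge0 lr) betaP.
have li : 0 < lambda^-1 by rewrite invr_gt0.
have r3 := ler_wpM2l (ltW li) r2.
rewrite /alpha_min in aP; rewrite /beta_min in bP.
set Q := alpha * lw ^+ 2 + _ + _ + _.
have QP : lambda * kappa / 2 * nu ^+ 2 + w ^+ 2 + lambda^-1 * r ^+ 2
    + g ^+ 2 / 2 <= Q.
  by rewrite /Q; lra.
have k2 : 0 <= 2 + 2 / kappa by rewrite addr_ge0// divr_ge0// ltW.
apply: le_trans (ler_wpM2l k2 QP).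
have lr0 : 0 <= lambda^-1 * r ^+ 2 by rewrite mulr_ge0// ltW.
have lu0 : 0 <= lambda * nu ^+ 2 by rewrite mulr_ge0// ltW.
rewrite [leRHS](_ : _ = lambda * nu ^+ 2 + 2 * w ^+ 2 + 2 * (lambda^-1 * r ^+ 2)
  + g ^+ 2 + kappa * (lambda * nu ^+ 2) + kappa^-1 * (2 * w ^+ 2
     + 2 * (lambda^-1 * r ^+ 2) + g ^+ 2)); last first.
  by field; rewrite !gt_eqF.
have k1 : 0 <= kappa * (lambda * nu ^+ 2) by rewrite mulr_ge0// ltW.
have k3 : 0 <= kappa^-1 * (2 * w ^+ 2 + 2 * (lambda^-1 * r ^+ 2) + g ^+ 2).
  by rewrite mulr_ge0 ?invr_ge0 ?(ltW kappa_gt0)//; lra.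
lra.
Qed.

(** The continuity constant. The terms of the form that carry neither [alpha]
    nor [beta] are charged to the maximum of [alpha] and [lambda * beta], which is
    at least [alpha_min]; this explains the denominator. *)
Definition form_bound :=
  kL ^+ 2 + kLs ^+ 2 + (kC + kI * kLs + 1 + kA) / alpha_min.

Lemma form_bound_gt0 : 0 < form_bound.
Proof.
by rewrite ltr_wpDr ?addr_gt0 ?exprn_gt0// divr_ge0 ?(ltW alpha_min_gt0)//;
  rewrite !addr_ge0 ?mulr_ge0 ?(ltW kC_gt0) ?(ltW kI_gt0) ?(ltW kLs_gt0)
   ?(ltW kA_gt0).
Qed.

Lemma ls_form_bounded (lambda alpha beta : R) u y p v z q : 0 < lambda ->
  alpha_min <= alpha -> 0 <= beta ->
  `|a lambda alpha beta u y p v z q| <= form_bound *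
     (Num.max alpha (lambda * beta) * norm lambda u y p * norm lambda v z q).
Proof.
move=> l0 alphaP beta0; have alpha0 := lt_le_trans alpha_min_gt0 alphaP.
have [u1 u2 u3 u4] := triple_norm_components u y p l0.
have [v1 v2 v3 v4] := triple_norm_components v z q l0.
have N0 := triple_norm_ge0 lambda u y p.
have N0' := triple_norm_ge0 lambda v z q.
rewrite ls_formE.
have s0 : 0 < Num.sqrt lambda by rewrite sqrtr_gt0.
have s2 : Num.sqrt lambda * Num.sqrt lambda = lambda.
  by rewrite -expr2 sqr_sqrtr// ltW.
move: (norm lambda u y p) (norm lambda v z q) (Num.sqrt lambda)
  s0 s2 u1 u2 u3 u4 v1 v2 v3 v4 N0 N0'.
move=> N N' s s0 s2 u1 u2 u3 u4 v1 v2 v3 v4 N0 N0'.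
have t1 : `|alpha * inner (L (y - S u)) (L (z - S v))|
    <= kL ^+ 2 * alpha * (N * N').
  rewrite normrM gtr0_norm// [kL ^+ 2 * _]mulrC -mulrA ler_wpM2l ?(ltW alpha0)//.
  rewrite (le_trans (cauchy_schwarz _ _))// expr2 mulrACA ler_pM//.
    by rewrite (le_trans (L_bnd _))// ler_wpM2l// ltW.
  by rewrite (le_trans (L_bnd _))// ler_wpM2l// ltW.
have t2 : `|beta * inner (Ls (p - G y)) (Ls (q - G z))|
    <= kLs ^+ 2 * (lambda * beta) * (N * N').
  rewrite normrM ger0_norm//.
  rewrite (_ : kLs ^+ 2 * _ * _ = beta * ((kLs * (s * N)) *
    (kLs * (s * N')))); last by rewrite -s2; ring.
  rewrite ler_wpM2l// (le_trans (cauchy_schwarz _ _))// ler_pM//.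
    by rewrite (le_trans (Ls_bnd _))// ler_wpM2l// ltW.
  by rewrite (le_trans (Ls_bnd _))// ler_wpM2l// ltW.
have t3 : `|lambda * inner (C u) v| <= kC * (N * N').
  rewrite normrM gtr0_norm//.
  apply: (@le_trans _ _ (lambda * (kC * `|u| * `|v|))).
    rewrite ler_wpM2l ?(ltW l0)// (le_trans (cauchy_schwarz _ _))//.
    by rewrite ler_wpM2r.
  rewrite (_ : lambda * _ = kC * ((s * `|u|)
    * (s * `|v|))); last by rewrite -s2; ring.
  by rewrite ler_wpM2l ?(ltW kC_gt0)// ler_pM// mulr_ge0// ltW.
have t4 : `|inner (I (S v)) (Ls (p - G y))| <= kI * kLs * (N * N').
  rewrite (le_trans (cauchy_schwarz _ _))//.
  apply: (@le_trans _ _ (kI * `|v| * (kLs * (s * N)))).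
    by rewrite ler_pM// (le_trans (Ls_bnd _))// ler_wpM2l// ltW.
  rewrite (_ : kI * `|v| * _ = kI * kLs * (N * (s * `|v|)));
    last by ring.
  by rewrite ler_wpM2l ?mulr_ge0 ?(ltW kI_gt0) ?(ltW kLs_gt0)// ler_wpM2l.
have t5 : `|inner (A (I (S v))) (A (I (S u)))| <= N * N'.
  by rewrite (le_trans (cauchy_schwarz _ _))// mulrC ler_pM.
have t6 : `|inner (A (I (S v))) (A (I (y - S u)))| <= kA * (N * N').
  rewrite (le_trans (cauchy_schwarz _ _))// [N * _]mulrC mulrCA ler_pM//.
  by rewrite (le_trans (AI_bnd _))// ler_wpM2l// ltW.
set mx := Num.max alpha (lambda * beta).
have NN : 0 <= N * N' by rewrite mulr_ge0.
have m1 : alpha <= mx by rewrite le_max lexx.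
have m2 : lambda * beta <= mx by rewrite le_max lexx orbT.
have m3 : 1 <= mx / alpha_min.
  by rewrite ler_pdivlMr ?alpha_min_gt0// mul1r (le_trans alphaP).
apply: (@le_trans _ _ (kL ^+ 2 * alpha * (N * N')
   + kLs ^+ 2 * (lambda * beta) * (N * N')
   + kC * (N * N') + (kI * kLs * (N * N') + N * N' + kA * (N * N')))).
  by do 5! [rewrite (le_trans (ler_normD _ _))// lerD//].
rewrite (_ : form_bound * _ = kL ^+ 2 * mx * (N * N') + kLs ^+ 2 * mx * (N * N')
   + (kC + kI * kLs + 1 + kA) * (mx / alpha_min) * (N * N')); last first.
  by rewrite /form_bound; ring.
have q1 : kL ^+ 2 * alpha * (N * N') <= kL ^+ 2 * mx * (N * N').
  by rewrite ler_wpM2r// ler_wpM2l// sqr_ge0.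
have q2 : kLs ^+ 2 * (lambda * beta) * (N * N') <= kLs ^+ 2 * mx * (N * N').
  by rewrite ler_wpM2r// ler_wpM2l// sqr_ge0.
have kk : 0 <= kC + kI * kLs + 1 + kA.
  by rewrite !addr_ge0 ?mulr_ge0 ?ltW.
have := ler_wpM2r NN (ler_wpM2l kk m3); rewrite mulr1; lra.
Qed.

(** * Well-posedness *)

Lemma ls_form_scalarl (lambda alpha beta : R) v z q (k : R) u y p u' y' p' :
  a lambda alpha beta (k *: u + u') (k *: y + y') (k *: p + p') v z q
  = k * a lambda alpha beta u y p v z q + a lambda alpha beta u' y' p' v z q.
Proof. by rewrite /a /ls_form !linearP/= !innerE; ring. Qed.

Lemma ls_form_scalarr (lambda alpha beta : R) u y p (k : R) v z q v' z' q' :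
  a lambda alpha beta u y p (k *: v + v') (k *: z + z') (k *: q + q')
  = k * a lambda alpha beta u y p v z q + a lambda alpha beta u y p v' z' q'.
Proof. by rewrite /a /ls_form !linearP/= !innerE; ring. Qed.

Lemma ls_load_scalar (alpha beta : R) f zd (k : R) v z q v' z' q' :
  l alpha beta f zd (k *: v + v') (k *: z + z') (k *: q + q')
  = k * l alpha beta f zd v z q + l alpha beta f zd v' z' q'.
Proof. by rewrite /l /ls_load !linearP/= !innerE; ring. Qed.

Notation T := (hprod (hprod X Y) P).
Let nrm (lambda : R) (x : T) := norm lambda x.1.1 x.1.2 x.2.

Lemma hprod3_norm_sqr (x : T) :
  `|x| ^+ 2 = `|x.1.1| ^+ 2 + `|x.1.2| ^+ 2 + `|x.2| ^+ 2.
Proof. by rewrite !hprod_norm_sqr. Qed.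

Lemma hprod3_norm_components (x : T) :
  [/\ `|x.1.1| <= `|x|, `|x.1.2| <= `|x| & `|x.2| <= `|x|].
Proof.
split; last exact: hprod_norm_snd.
  exact: le_trans (hprod_norm_fst _) (hprod_norm_fst x).
exact: le_trans (hprod_norm_snd _) (hprod_norm_fst x).
Qed.

(** The constants in the next two lemmas depend on [lambda], which is harmless:
    they serve only for existence and uniqueness. *)
Lemma triple_norm_upper (lambda : R) : 0 < lambda <= 1 ->
  exists2 c : R, 0 < c & forall x : T, nrm lambda x <= c * `|x|.
Proof.
move=> /andP[l0 l1]; have li : 0 < lambda^-1 by rewrite invr_gt0.
pose c2 := 1 + (1 + kS) ^+ 2 + lambda^-1 * (1 + kG) ^+ 2 + (kA * kS) ^+ 2.
have c20 : 0 < c2.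
  by rewrite !ltr_wpDr ?sqr_ge0// mulr_ge0 ?sqr_ge0// ltW.
exists (Num.sqrt c2) => [|x]; first by rewrite sqrtr_gt0.
have [x1 x2 x3] := hprod3_norm_components x.
rewrite -(ler_pXn2r (ltn0Sn 1)) ?nnegrE ?triple_norm_ge0 ?mulr_ge0 ?sqrtr_ge0//.
rewrite /nrm triple_norm_sqr// exprMn (sqr_sqrtr (ltW c20)).
move: {x}`|x| x.1.1 x.1.2 x.2 (normr_ge0 x) x1 x2 x3 => n u y p n0 x1 x2 x3.
have sq (s t k : R) : 0 <= s -> s <= k * t -> s ^+ 2 <= k ^+ 2 * t ^+ 2.
  move=> s0 st; rewrite -exprMn ler_pXn2r ?nnegrE//.
  exact: le_trans st.
have h1 : `|u| ^+ 2 <= n ^+ 2 by rewrite ler_pXn2r ?nnegrE.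
have h1' : lambda * `|u| ^+ 2 <= n ^+ 2.
  by rewrite (le_trans _ h1)// ler_piMl// sqr_ge0.
have S_n : `|S u| <= kS * n.
  by rewrite (le_trans (S_bnd u))// ler_wpM2l// ltW.
have h2 : `|y - S u| <= (1 + kS) * n.
  by rewrite mulrDl mul1r (le_trans (ler_normB _ _))// lerD.
have h3 : `|p - G y| <= (1 + kG) * n.
  rewrite mulrDl mul1r (le_trans (ler_normB _ _))// lerD//.
  by rewrite (le_trans (G_bnd y))// ler_wpM2l// ltW.
have h4 : `|A (I (S u))| <= kA * kS * n.
  by rewrite -mulrA (le_trans (AI_bnd _))// ler_wpM2l// ltW.
have := sq _ _ _ (normr_ge0 _) h4; have := sq _ _ _ (normr_ge0 _) h2.
have := ler_wpM2l (ltW li) (sq _ _ _ (normr_ge0 _) h3).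
rewrite /c2; lra.
Qed.

Lemma triple_norm_lower (lambda : R) : 0 < lambda <= 1 ->
  exists2 c : R, 0 < c & forall x : T, c * `|x| ^+ 2 <= nrm lambda x ^+ 2.
Proof.
move=> /andP[l0 l1]; pose s := Num.sqrt lambda.
have s0 : 0 < s by rewrite sqrtr_gt0.
pose c1 := s^-1; pose c2 := 1 + kS * c1; pose c3 := s + kG * c2.
have c10 : 0 < c1 by rewrite invr_gt0.
have c20 : 0 < c2 by rewrite addr_gt0// mulr_gt0.
have c30 : 0 < c3 by rewrite addr_gt0// mulr_gt0.
have cc : 0 < c1 ^+ 2 + c2 ^+ 2 + c3 ^+ 2 by rewrite !addr_gt0 ?exprn_gt0.
exists (c1 ^+ 2 + c2 ^+ 2 + c3 ^+ 2)^-1 => [|x]; first by rewrite invr_gt0.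
rewrite ler_pdivrMl// hprod3_norm_sqr /nrm.
move: x.1.1 x.1.2 x.2 => u y p.
have [u1 u2 u3 _] := triple_norm_components u y p l0.
have N0 := triple_norm_ge0 lambda u y p.
move: (norm lambda u y p) u1 u2 u3 N0; rewrite -/s => N u1 u2 u3 N0.
have sq (t k : R) : 0 <= t -> t <= k * N -> t ^+ 2 <= k ^+ 2 * N ^+ 2.
  move=> t0 tN; rewrite -exprMn ler_pXn2r ?nnegrE//.
  exact: le_trans tN.
have h1 : `|u| <= c1 * N by rewrite ler_pdivlMl.
have h2 : `|y| <= c2 * N.
  rewrite -[y](subrK (S u)) (le_trans (ler_normD _ _))// mulrDl mul1r lerD//.
  by rewrite (le_trans (S_bnd u))// -mulrA ler_wpM2l// ltW.
have h3 : `|p| <= c3 * N.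
  rewrite -[p](subrK (G y)) (le_trans (ler_normD _ _))// mulrDl lerD//.
  by rewrite (le_trans (G_bnd y))// -mulrA ler_wpM2l// ltW.
have := sq _ _ (normr_ge0 _) h1; have := sq _ _ (normr_ge0 _) h2.
have := sq _ _ (normr_ge0 _) h3; lra.
Qed.

Lemma ls_load_bounded (lambda alpha beta : R) f zd : 0 < lambda ->
  0 < alpha -> 0 < beta ->
  exists N : R, forall v z q,
    `|l alpha beta f zd v z q| <= N * norm lambda v z q.
Proof.
move=> l0 alpha0 beta0.
exists (alpha * (`|f| * kL)
  + beta * (`|- As zd| * (kLs * Num.sqrt lambda))) => v z q.
have [_ v2 v3 _] := triple_norm_components v z q l0.
rewrite /l /ls_load state_residual adjoint_residual.
rewrite (le_trans (ler_normD _ _))// mulrDl lerD//.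
  rewrite normrM (gtr0_norm alpha0) -!mulrA ler_wpM2l ?(ltW alpha0)//.
  rewrite (le_trans (cauchy_schwarz _ _))// ler_wpM2l//.
  by rewrite (le_trans (L_bnd _))// ler_wpM2l// ltW.
rewrite normrM (gtr0_norm beta0) -!mulrA ler_wpM2l ?(ltW beta0)//.
rewrite (le_trans (cauchy_schwarz _ _))// ler_wpM2l//.
by rewrite (le_trans (Ls_bnd _))// ler_wpM2l// ltW.
Qed.

Lemma vi_wellposed (lambda alpha beta : R) f zd (W : set (X * Y * P)) :
  0 < lambda <= 1 -> alpha_min <= alpha -> beta_min * lambda^-1 <= beta ->
  W !=set0 -> closed W -> convex_set W ->
  exists! x, vi_solution (a lambda alpha beta) (l alpha beta f zd) W x.
Proof.
move=> l01 alphaP betaP W0 W_closed W_convex; have /andP[l0 _] := l01.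
have alpha0 := lt_le_trans alpha_min_gt0 alphaP.
have beta0 : 0 < beta.
  by apply: lt_le_trans betaP; rewrite divr_gt0// beta_min_gt0.
have [cu cu0 cuP] := triple_norm_upper l01.
have [cl cl0 clP] := triple_norm_lower l01.
have [N NP] := ls_load_bounded f zd l0 alpha0 beta0.
pose b (x x' : T) :=
  a lambda alpha beta x.1.1 x.1.2 x.2 x'.1.1 x'.1.2 x'.2.
pose h (x : T) := l alpha beta f zd x.1.1 x.1.2 x.2.
pose mx := Num.max alpha (lambda * beta).
have b_linl x' : scalar (b^~ x') by move=> k x y; exact: ls_form_scalarl.
have b_linr x : scalar (b x) by move=> k y z; exact: ls_form_scalarr.
have h_lin : scalar h by move=> k x y; exact: ls_load_scalar.
have nrm0 x : 0 <= nrm lambda x by exact: triple_norm_ge0.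
have mx0 : 0 < mx by rewrite lt_max alpha0.
have b_bnd x x' : `|b x x'| <= form_bound * mx * cu ^+ 2 * `|x| * `|x'|.
  apply: le_trans (ls_form_bounded _ _ _ _ _ _ l0 alphaP (ltW beta0)) _.
  rewrite (_ : form_bound * mx * _ * _ * _
    = form_bound * (mx * (cu * `|x|) * (cu * `|x'|))); last by ring.
  rewrite ler_wpM2l ?(ltW form_bound_gt0)//.
  rewrite ler_pM ?mulr_ge0 ?triple_norm_ge0 ?(ltW mx0)//; last exact: cuP.
  by rewrite ler_wpM2l ?(ltW mx0)//; exact: cuP.
have k20 : 0 < 2 + 2 / kappa by rewrite addr_gt0// divr_gt0.
have b_coer x : cl / (2 + 2 / kappa) * `|x| ^+ 2 <= b x x.
  rewrite mulrAC ler_pdivrMr// mulrC [_ * (2 + _)]mulrC.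
  rewrite [_ * cl]mulrC (le_trans (clP x))//.
  exact: ls_form_coercive.
have c0 : 0 < cl / (2 + 2 / kappa) by rewrite divr_gt0.
have h_bnd x : `|h x| <= `|N| * cu * `|x|.
  apply: le_trans (NP _ _ _) _; rewrite -mulrA.
  by rewrite (le_trans (ler_wpM2r (nrm0 x) (ler_norm N)))// ler_wpM2l.
have [[[u y] p] Wx xP] := stampacchia (W := W : set T) W0
  (hprod3_closed W_closed) W_convex b_linl b_linr b_bnd c0 b_coer h_lin h_bnd.
exists (u, y, p); split.
  by split => // v z q Wv; exact: (xP (v, z, q) Wv).
move=> [[u' y'] p'] [Wx' x'P].
apply: (stampacchia_unique (W := W : set T) b_linl b_linr c0 b_coer h_lin Wx Wx' xP).
by move=> [[v z] q] Wv; exact: x'P.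
Qed.

(** From the inequality to the system: the control is kept fixed, and increments
    of the state and the adjoint that reproduce the negative residuals give
    [0 <= - alpha * `|r1| ^+ 2 - beta * `|r2| ^+ 2]. *)
Lemma vi_solution_optimality (lambda alpha beta : R) f zd (Xad : set X) x :
  0 < alpha -> 0 < beta ->
  vi_solution (a lambda alpha beta) (l alpha beta f zd)
    (Xad `*` setT `*` setT) x <->
  optimality_system A As B Bs C L I Ls Is lambda f zd Xad x.
Proof.
move=> alpha0 beta0; case: x => [[u y] p].
have E v z q : a lambda alpha beta u y p v z q - l alpha beta f zd v z q =
    alpha * inner (L y + B u - f) (L z + B v)
    + beta * inner (Ls p - As (A (I y) - zd)) (Ls q - As (A (I z)))
    + inner (- Bs (Is p) + lambda *: C u) v.
  by rewrite /a /l /ls_form /ls_load !linearB/= !innerE; ring.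
split => [[[[Wu _] _] xP]|[Wu Ly Lp uP]].
  have [gL LK gK] := L_bij; have [gLs LsK gsK] := Ls_bij.
  pose r1 := L y + B u - f; pose r2 := Ls p - As (A (I y) - zd).
  pose z := gL (- r1); pose q := gLs (As (A (I z)) - r2).
  have := xP u (y + z) (p + q) (conj (conj Wu Logic.I) Logic.I).
  rewrite subrr (addrC y) (addrC p) !addrK -subr_ge0 E.
  rewrite -/r1 -/r2 linear0 addr0 inner0r addr0 gK gsK.
  rewrite addrAC subrr add0r !innerNr !inner_norm => r12.
  have r10 : `|r1| ^+ 2 = 0.
    apply/le_anti; rewrite sqr_ge0 andbT -(ler_pM2l alpha0) mulr0.
    by have := mulr_ge0 (ltW beta0) (sqr_ge0 `|r2|); lra.
  have r20 : `|r2| ^+ 2 = 0.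
    apply/le_anti; rewrite sqr_ge0 andbT -(ler_pM2l beta0) mulr0.
    by have := mulr_ge0 (ltW alpha0) (sqr_ge0 `|r1|); lra.
  move: r10 r20 => /eqP; rewrite sqrf_eq0 normr_eq0 => /eqP r10.
  move=> /eqP; rewrite sqrf_eq0 normr_eq0 => /eqP r20.
  split => //.
  - by apply/eqP; rewrite -subr_eq0 opprB addrA -/r1 r10.
  - by apply/eqP; rewrite -subr_eq0 -/r2 r20.
  - move=> v Wv; have := xP v y p (conj (conj Wv Logic.I) Logic.I).
    by rewrite -subr_ge0 E -/r1 -/r2 r10 r20 !inner0l !mulr0 !add0r.
split => // v z q [[Wv _] _].
rewrite -subr_ge0 E Ly Lp subrK !subrr !inner0l !mulr0 !add0r.
exact: uP.
Qed.

End least_squares_estimates.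

Theorem theorem6 (R : realType) (H X Y Ystar : hilbertType R) (Xad : set X)
    (n : nat) (d m : 'I_n -> nat) (Omega : forall j, lipschitz_domain R (d j))
    (A : {linear L2_product m Omega -> H})
    (Astar : {linear H -> L2_product m Omega})
    (B : {linear X -> L2_product m Omega})
    (Bstar : {linear L2_product m Omega -> X})
    (C : {linear X -> X})
    (L I : {linear Y -> L2_product m Omega})
    (Lstar Istar : {linear Ystar -> L2_product m Omega})
    (kappa : R)
    (Xad_neq0 : Xad !=set0) (Xad_closed : closed Xad)
    (Xad_convex : convex_set Xad)
    (A_bounded : bounded_operator A) (B_bounded : bounded_operator B)
    (C_bounded : bounded_operator C)
    (A_adjoint : is_adjoint A Astar) (B_adjoint : is_adjoint B Bstar)
    (C_self_adjoint : is_adjoint C C)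
    (kappa_gt0 : 0 < kappa)
    (C_coercive : forall u, inner (C u) u >= kappa * `|u| ^+ 2)
    (L_bounded : bounded_operator L) (L_bijective : bijective L)
    (Lstar_bounded : bounded_operator Lstar)
    (Lstar_bijective : bijective Lstar)
    (I_bounded : bounded_operator I) (Istar_bounded : bounded_operator Istar)
    (L_I_symmetry : forall y p, inner (L y) (Istar p) = inner (I y) (Lstar p)) :
  let a := ls_form A Astar B Bstar C L I Lstar Istar in
  let l := ls_load A Astar B L I Lstar in
  let norm := triple_norm A Astar B L I Lstar in
  exists alpha0 beta0 : R -> R,
  [/\ (* alpha0 and 1 are equivalent *)
      exists2 c : R, 0 < c & forall lambda : R, 0 < lambda <= 1 ->
        alpha0 lambda <= c * 1 /\ 1 <= c * alpha0 lambda,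
      (* beta0 and lambda^-1 are equivalent *)
      exists2 c : R, 0 < c & forall lambda : R, 0 < lambda <= 1 ->
        beta0 lambda <= c * lambda^-1 /\ lambda^-1 <= c * beta0 lambda,
      (* coercivity *)
      exists2 c : R, 0 < c & forall lambda alpha beta : R, 0 < lambda <= 1 ->
        alpha0 lambda <= alpha -> beta0 lambda <= beta ->
        forall u y p,
          norm lambda u y p ^+ 2 <= c * a lambda alpha beta u y p u y p,
      (* boundedness *)
      exists2 c : R, 0 < c & forall lambda alpha beta : R, 0 < lambda <= 1 ->
        alpha0 lambda <= alpha -> beta0 lambda <= beta ->
        forall u y p v z q,
          `|a lambda alpha beta u y p v z q| <=
          c * (Num.max alpha (lambda * beta)
               * norm lambda u y p * norm lambda v z q) &
      (* well-posedness *)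
      forall lambda alpha beta : R, 0 < lambda <= 1 ->
        alpha0 lambda <= alpha -> beta0 lambda <= beta ->
        forall (f : L2_product m Omega) (zd : H),
        [/\ forall W : set (X * Y * Ystar),
              W !=set0 -> closed W -> convex_set W ->
              exists! x, vi_solution (a lambda alpha beta)
                           (l alpha beta f zd) W x,
            exists! x, vi_solution (a lambda alpha beta) (l alpha beta f zd)
                         (Xad `*` setT `*` setT) x &
            exists! x, optimality_system A Astar B Bstar C L I Lstar Istar
                         lambda f zd Xad x]].
Proof.
move=> a l norm.
have [mL mL0 L_below] := bounded_inverse L_bounded L_bijective.
have [mLs mLs0 Ls_below] := bounded_inverse Lstar_bounded Lstar_bijective.
have [kL kL0 L_bnd] := bounded_operator_pos L_bounded.
have [kLs kLs0 Ls_bnd] := bounded_operator_pos Lstar_bounded.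
have [kA kA0 A_bnd] := bounded_operator_pos A_bounded.
have [kB kB0 B_bnd] := bounded_operator_pos B_bounded.
have [kC kC0 C_bnd] := bounded_operator_pos C_bounded.
have [kI kI0 I_bnd] := bounded_operator_pos I_bounded.
(* Continuity of the solution maps, from the bounded inverses. *)
have S_bnd u : `|state B L u| <= mL * kB * `|u|.
  rewrite (le_trans (L_below _))// stateE// normrN -mulrA.
  by rewrite ler_wpM2l// ltW.
have IS_bnd u : `|I (state B L u)| <= kI * (mL * kB) * `|u|.
  by rewrite (le_trans (I_bnd _))// -mulrA ler_wpM2l// ltW.
have AI_bnd y : `|A (I y)| <= kA * kI * `|y|.
  by rewrite (le_trans (A_bnd _))// -mulrA ler_wpM2l// ltW.
have As_bnd := adjoint_bound A_adjoint A_bnd (ltW kA0).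
have G_bnd y : `|adjoint_state A Astar I Lstar y|
    <= mLs * (kA * (kA * kI)) * `|y|.
  rewrite (le_trans (Ls_below _))// adjoint_stateE// -!mulrA.
  rewrite ler_wpM2l ?(ltW mLs0)// (le_trans (As_bnd _))//.
  by rewrite ler_wpM2l ?(ltW kA0)// mulrA.
have kAI0 : 0 < kA * kI by rewrite mulr_gt0.
have kS0 : 0 < mL * kB by rewrite mulr_gt0.
have kIS0 : 0 < kI * (mL * kB) by rewrite mulr_gt0.
have kG0 : 0 < mLs * (kA * (kA * kI)) by rewrite !mulr_gt0.
pose am := alpha_min mL (kA * kI).
pose bm := beta_min kappa mLs (kI * (mL * kB)).
have am0 : 0 < am by exact: alpha_min_gt0.
have bm0 : 0 < bm by exact: beta_min_gt0.
exists (fun=> am), (fun lambda => bm * lambda^-1); split.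
- exists (am + am^-1) => [|lambda _]; first by rewrite addr_gt0// invr_gt0.
  rewrite mulr1 lerDl invr_ge0 ltW//; split => //.
  by rewrite mulrDl mulVf ?gt_eqF// lerDr mulr_ge0// ltW.
- exists (bm + bm^-1) => [|lambda /andP[l0 _]]; first by rewrite addr_gt0// invr_gt0.
  have li : 0 < lambda^-1 by rewrite invr_gt0.
  split; first by rewrite ler_wpM2r ?(ltW li)// lerDl invr_ge0 ltW.
  rewrite mulrA -[leLHS]mul1r ler_wpM2r ?(ltW li)//.
  by rewrite mulrDl mulVf ?gt_eqF// lerDr mulr_ge0// ltW.
- exists (2 + 2 / kappa) => [|lambda alpha beta /andP[l0 _] aP bP u y p].
    by rewrite addr_gt0// divr_gt0.
  exact: (ls_form_coercive A_adjoint B_adjoint L_bijective Lstar_bijective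
    L_I_symmetry kappa_gt0 C_coercive mL0 mLs0 kAI0 L_below Ls_below AI_bnd
    IS_bnd).
- exists (form_bound mL kL kLs (kA * kI) kC (kI * (mL * kB))).
    exact: form_bound_gt0.
  move=> lambda alpha beta /andP[l0 _] aP bP u y p v z q.
  apply: (ls_form_bounded A_adjoint B_adjoint L_bijective Lstar_bijective
    L_I_symmetry mL0 kL0 kLs0 kAI0 kC0 kIS0 L_bnd Ls_bnd AI_bnd C_bnd IS_bnd)
    => //.
  by apply: le_trans bP; rewrite mulr_ge0 ?invr_ge0 ?ltW.
- move=> lambda alpha beta l01 aP bP f zd; have /andP[l0 _] := l01.
  have alpha0 : 0 < alpha by exact: lt_le_trans aP.
  have beta0 : 0 < beta.
    by apply: lt_le_trans bP; rewrite mulr_gt0// invr_gt0.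
  have wp (W : set (X * Y * Ystar)) : W !=set0 -> closed W -> convex_set W ->
      exists! x, vi_solution (a lambda alpha beta) (l alpha beta f zd) W x.
    exact: (vi_wellposed A_adjoint B_adjoint L_bijective Lstar_bijective
      L_I_symmetry kappa_gt0 C_coercive mL0 mLs0 kL0 kLs0 kAI0 kC0 kIS0 kS0 kG0
      L_below Ls_below L_bnd Ls_bnd AI_bnd C_bnd IS_bnd S_bnd G_bnd).
  have wp_ad : exists! x, vi_solution (a lambda alpha beta) (l alpha beta f zd)
      (Xad `*` setT `*` setT) x.
    apply: wp.
    + by have [u Xu] := Xad_neq0; exists (u, 0, 0).
    + have -> : Xad `*` setT `*` setT
          = (fun x : X * Y * Ystar => x.1.1) @^-1` Xad.
        by apply/seteqP; split => [[[u y] p] [[]]|[[u y] p]].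
      apply: preimage_closed => // x _.
      by apply: (@continuous_comp _ _ _ fst fst); exact: cvg_fst.
    + move=> x x' t; rewrite !inE => -[[xX _] _] [[x'X _] _].
      have := Xad_convex x.1.1 x'.1.1 t; rewrite !inE => /(_ xX x'X) h.
      by split.
  split => //.
  have [x [xP x_uniq]] := wp_ad.
  have vi_opt x' := vi_solution_optimality A Astar B Bstar C I Istar
    L_bijective Lstar_bijective lambda f zd Xad x' alpha0 beta0.
  exists x; split; first exact/vi_opt.
  by move=> x' /vi_opt x'P; exact: x_uniq.
Qed.
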